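(* Let $P=S^2\times\mathbb{R}$, with coordinates $(x,t)$, be equipped with the Poisson structure $\pi_P$ whose symplectic leaves are the spheres $S^2\times\{t\}$, $t\in\mathbb{R}$, each endowed with $(1+t^2)$ times the usual symplectic structure of $S^2$. There exist a Lie group $G$ and a presymplectic manifold $(M,\omega)$ (a manifold with a closed 2-form) carrying a free and proper $G$-action preserving $\omega$ for which $P=M/G$ and the quotient map $M\to P$ is a forward Dirac map; i.e., if $L$ is the graph of $\omega$, then $L_{quot}$ is the graph of $\pi_P$.
   Context: The graph of a closed 2-form $\omega$ on $M$ is the Dirac structure $L=\{(X,i_X\omega): X\in TM\}\subset TM\oplus T^*M$; the graph of a Poisson structure $\pi$ is $\{(\pi^\sharp(\alpha),\alpha):\alpha\in T^*P\}$, $\pi^\sharp(\alpha)=i_\alpha\pi$. With $p:M\to M/G=P$ the quotient map, $L_{quot}$ is the push-forward $(L_{quot})_{p(x)}=\{(\mathrm{d}p(X),\beta): X\in T_xM,\ \beta\in T^*_{p(x)}P,\ (X,(\mathrm{d}p)^*\beta)\in L_x\}$ (independent of the choice of $x$ in the fibre by $G$-invariance; a Dirac structure on $M/G$ when $L\cap (TM\oplus K^\circ)$ has constant rank, $K\subseteq TM$ being the tangent distribution to the $G$-orbits and $K^\circ$ its annihilator). The map $p$ being a forward Dirac map from $(M,\omega)$ to $(P,\pi_P)$ means that this push-forward equals the graph of $\pi_P$ at every point. ''$P=M/G$'' means an identification by a diffeomorphism. The ''usual symplectic structure of $S^2$'' is the standard area form. *)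

(* Defs.v *)
(* Conventions.  Tangent vectors are row vectors, covectors are column vectors,
   the pairing being matrix multiplication, and Jacobians act on row vectors by
   right multiplication (as 'J does in MathComp-Analysis).  Each point x of a
   manifold comes with a preferred chart chart_at x around it, and T_x M is
   'rV_(dim M) through that chart, so a 2-form or a bivector at x is a matrix. *)
From HB Require Import structures.
From mathcomp Require Import all_boot all_order all_algebra.
From mathcomp Require Import all_classical all_reals all_analysis.
From mathcomp Require Import ring.
Set Implicit Arguments.
Unset Strict Implicit.
Unset Printing Implicit Defensive.
Import Order.TTheory GRing.Theory Num.Theory.
Import numFieldNormedType.Exports.
Local Open Scope classical_set_scope.
Local Open Scope ring_scope.

Section Smooth.
Context {R : realType} {V W : normedModType R}.

(* Only meant for open U. *)
Fixpoint Ck_on (k : nat) (U : set V) (f : V -> W) : Prop :=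
  if k is k'.+1 then
    (forall x, U x -> differentiable f x) /\ (forall v, Ck_on k' U ('D_v f))
  else forall x, U x -> {for x, continuous f}.

Definition smooth_on (U : set V) (f : V -> W) : Prop :=
  forall k, Ck_on k U f.

End Smooth.

(* chart_inv is only relevant on the image of chart_dom. *)
Record chart (R : realType) (T : Type) (n : nat) := Chart {
  chart_dom : set T;
  chart_map : T -> 'rV[R]_n;
  chart_inv : 'rV[R]_n -> T }.

Definition chart_img (R : realType) (T : Type) n (c : chart R T n) :
  set 'rV[R]_n := chart_map c @` chart_dom c.

Record premanifold (R : realType) := PreManifold {
  carrier :> topologicalType;
  dim : nat;
  atlas : set (chart R carrier dim);
  chart_at : carrier -> chart R carrier dim }.

Arguments atlas {R} _.
Arguments chart_at {R p} _.

Section Manifolds.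
Context {R : realType}.
Implicit Types M N : premanifold R.

Definition is_chart M (c : chart R M (dim M)) : Prop :=
  [/\ open (chart_dom c),
      open (chart_img c),
      (forall x, chart_dom c x -> chart_inv c (chart_map c x) = x),
      (forall x, chart_dom c x -> {for x, continuous (chart_map c)}) &
      (forall u, chart_img c u -> {for u, continuous (chart_inv c)})].

Definition is_manifold M : Prop :=
  [/\ hausdorff_space M,
      @second_countable M,
      (forall x : M, atlas M (chart_at x) /\ chart_dom (chart_at x) x),
      (forall c, atlas M c -> is_chart c) &
      (forall c d, atlas M c -> atlas M d ->
         smooth_on (chart_map c @` (chart_dom c `&` chart_dom d))
           (chart_map d \o chart_inv c))].

Definition smooth_map M N (f : M -> N) : Prop :=
  continuous f /\
  forall c d, atlas M c -> atlas N d ->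
    smooth_on (chart_map c @` (chart_dom c `&` f @^-1` chart_dom d))
      (chart_map d \o f \o chart_inv c).

(* The tangent map T_x M -> T_(f x) N. *)
Definition mdiff M N (f : M -> N) (x : M) : 'M[R]_(dim M, dim N) :=
  'J (chart_map (chart_at (f x)) \o f \o chart_inv (chart_at x))
     (chart_map (chart_at x) x).

Definition submersion M N (f : M -> N) : Prop :=
  smooth_map f /\ forall x, row_full (mdiff f x).

Definition immersion M N (f : M -> N) : Prop :=
  smooth_map f /\ forall x, row_free (mdiff f x).

Definition prod_chart M N (c : chart R M (dim M)) (d : chart R N (dim N)) :
    chart R (M * N)%type (dim M + dim N) :=
  Chart (chart_dom c `*` chart_dom d)
    (fun z => row_mx (chart_map c z.1) (chart_map d z.2))
    (fun u => (chart_inv c (lsubmx u), chart_inv d (rsubmx u))).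

Definition prod_manifold M N : premanifold R :=
  @PreManifold R (M * N)%type (dim M + dim N)
    [set prod_chart c d | c in atlas M & d in atlas N]
    (fun z => prod_chart (chart_at z.1) (chart_at z.2)).

(* The matrix w x represents the form (X, Y) |-> X *m w x *m Y^T on T_x M. *)
Definition form2 M := M -> 'M[R]_(dim M).

(* The coefficients of w in the coordinates of the chart c. *)
Definition form_in_chart M (c : chart R M (dim M)) (w : form2 M)
    (u : 'rV[R]_(dim M)) : 'M[R]_(dim M) :=
  let x := chart_inv c u in
  let J := 'J (chart_map (chart_at x) \o chart_inv c) u in
  J *m w x *m J^T.

Definition is_form2 M (w : form2 M) : Prop :=
  (forall x, (w x)^T = - w x) /\
  (forall c, atlas M c -> smooth_on (chart_img c) (form_in_chart c w)).

Definition partial n (i : 'I_n) (f : 'rV[R]_n -> R) (u : 'rV[R]_n) : R :=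
  'D_(delta_mx 0 i) (f : 'rV[R]_n -> R^o) u.

Definition closed_form M (w : form2 M) : Prop :=
  forall c u (i j k : 'I_(dim M)), atlas M c -> chart_img c u ->
  let wc a b := fun v => form_in_chart c w v a b in
  partial i (wc j k) u + partial j (wc k i) u + partial k (wc i j) u = 0.

Definition presymplectic M (w : form2 M) : Prop := is_form2 w /\ closed_form w.

Definition pullback M N (f : M -> N) (w : form2 N) : form2 M :=
  fun x => mdiff f x *m w (f x) *m (mdiff f x)^T.

(* The matrix q x represents (a, b) |-> a^T *m q x *m b on T*_x M; hence
   q^#(a) = i_a q is a^T *m q x, and the row space of q x is the image of q^#. *)
Definition bivector M := M -> 'M[R]_(dim M).

Definition sharp M (q : bivector M) (x : M) (a : 'cV[R]_(dim M)) :
  'rV[R]_(dim M) := a^T *m q x.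

Definition bivector_in_chart M (c : chart R M (dim M)) (q : bivector M)
    (u : 'rV[R]_(dim M)) : 'M[R]_(dim M) :=
  let x := chart_inv c u in
  let K := 'J (chart_map c \o chart_inv (chart_at x)) (chart_map (chart_at x) x)
  in K^T *m q x *m K.

(* The last clause is the Jacobi identity for the brackets of coordinates. *)
Definition is_poisson M (q : bivector M) : Prop :=
  [/\ (forall x, (q x)^T = - q x),
      (forall c, atlas M c -> smooth_on (chart_img c) (bivector_in_chart c q)) &
      (forall c u (i j k : 'I_(dim M)), atlas M c -> chart_img c u ->
         let qc a b := fun v => bivector_in_chart c q v a b in
         \sum_l (qc i l u * partial l (qc j k) u
               + qc j l u * partial l (qc k i) u
               + qc k l u * partial l (qc i j) u) = 0)].

(* Connected integral manifolds of the characteristic distribution im q^#;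
   S is immersed by j. *)
Definition integral_manifold M (q : bivector M) (S : premanifold R)
    (j : S -> M) : Prop :=
  [/\ is_manifold S, connected [set: S], injective j, immersion j &
      forall s, (mdiff j s == q (j s))%MS].

(* The leaf form sigma is determined by i_u sigma = j^* a whenever
   dj(u) = q^#(a): this makes the graph of q restrict to the graph of sigma. *)
Definition symplectic_leaf M (q : bivector M) (S : premanifold R)
    (sigma : form2 S) (j : S -> M) : Prop :=
  [/\ integral_manifold q j,
      (forall (S' : premanifold R) (j' : S' -> M),
         integral_manifold q j' -> range j `<=` range j' ->
         range j' `<=` range j) &
      (forall s (u : 'rV[R]_(dim S)) (a : 'cV[R]_(dim M)),
         u *m mdiff j s = sharp q (j s) a ->
         (u *m sigma s)^T = mdiff j s *m a)].

End Manifolds.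

Record lie_group (R : realType) := LieGroup {
  lie_space :> premanifold R;
  lie_mul : lie_space -> lie_space -> lie_space;
  lie_one : lie_space;
  lie_inv : lie_space -> lie_space;
  lie_manifold : is_manifold lie_space;
  lie_mulA : associative lie_mul;
  lie_mul1 : left_id lie_one lie_mul;
  lie_mulV : left_inverse lie_one lie_inv lie_mul;
  lie_mul_smooth : @smooth_map R (prod_manifold lie_space lie_space) lie_space
                     (fun z => lie_mul z.1 z.2);
  lie_inv_smooth : smooth_map lie_inv }.

Section Actions.
Context {R : realType} (G : lie_group R) (M : premanifold R).
Implicit Type act : G -> M -> M.

Definition smooth_action act : Prop :=
  [/\ (forall x, act (lie_one G) x = x),
      (forall g h x, act (lie_mul g h) x = act g (act h x)) &
      @smooth_map R (prod_manifold G M) M (fun z => act z.1 z.2)].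

Definition free_action act : Prop := forall g x, act g x = x -> g = lie_one G.

Definition proper_action act : Prop :=
  forall K : set (M * M), compact K ->
    compact ((fun z : G * M => (act z.1 z.2, z.2)) @^-1` K).

Definition preserves_form act (w : form2 M) : Prop :=
  forall g, pullback (act g) w =1 w.

(* M/G carries the unique smooth structure for which M -> M/G is a submersion,
   so an identification of P with M/G by a diffeomorphism is a surjective
   submersion onto P whose fibres are the orbits. *)
Definition quotient_map act (P : premanifold R) (p : M -> P) : Prop :=
  [/\ submersion p, set_surj [set: M] [set: P] p &
      forall x y, p x = p y <-> exists g, y = act g x].

End Actions.

Section Dirac.
Context {R : realType}.

(* Families of subsets of T_x M (+) T*_x M. *)
Definition tangent_cotangent_sets (M : premanifold R) :=
  M -> set ('rV[R]_(dim M) * 'cV[R]_(dim M)).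

Definition graph_form (M : premanifold R) (w : form2 M) :
    tangent_cotangent_sets M :=
  fun x => [set (X, (X *m w x)^T) | X in [set: 'rV[R]_(dim M)]].

Definition graph_bivector (P : premanifold R) (q : bivector P) :
    tangent_cotangent_sets P :=
  fun y => [set (sharp q y a, a) | a in [set: 'cV[R]_(dim P)]].

(* (L_quot)_(p x), computed at the point x of the fibre. *)
Definition pushforward (M P : premanifold R) (p : M -> P)
    (L : tangent_cotangent_sets M) (x : M) :
    set ('rV[R]_(dim P) * 'cV[R]_(dim P)) :=
  [set Yb | exists2 X, Yb.1 = X *m mdiff p x & L x (X, mdiff p x *m Yb.2)].

Definition forward_dirac (M P : premanifold R) (p : M -> P)
    (L : tangent_cotangent_sets M) (L' : tangent_cotangent_sets P) : Prop :=
  forall x, pushforward p L x = L' (p x).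

End Dirac.

Section SphereTimesLine.
Context (R : realType).

Definition euclid (n : nat) : premanifold R :=
  let c := Chart [set: 'rV[R]_n] id id in
  @PreManifold R 'rV[R]_n n [set c] (fun=> c).

Definition real_line : premanifold R :=
  let c := Chart [set: R] (fun t => const_mx t : 'rV[R]_1) (fun u => u 0 0) in
  @PreManifold R R 1 [set c] (fun=> c).

Definition unit_sphere : set 'rV[R]_3 := [set x | \sum_i x 0 i ^+ 2 = 1].

Definition coord3 (a b c : R) : 'rV[R]_3 := \row_i [:: a; b; c]`_i.

(* Stereographic projection of the sphere minus (0, 0, (-1)^b) from that point. *)
Definition stereo_map (b : bool) (x : unit_sphere) : 'rV[R]_2 :=
  let v : 'rV[R]_3 := \val x in
  \row_i ([:: v 0 0; v 0 1]`_i / (1 - (-1) ^+ b * v 0 ord_max)).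

Definition stereo_inv_val (b : bool) (u : 'rV[R]_2) : 'rV[R]_3 :=
  let r := u 0 0 ^+ 2 + u 0 1 ^+ 2 in
  \row_i ([:: 2 * u 0 0; 2 * u 0 1; (-1) ^+ b * (r - 1)]`_i / (r + 1)).

Lemma stereo_inv_subproof b u : stereo_inv_val b u \in unit_sphere.
Proof.
apply/mem_set; rewrite /unit_sphere /= !big_ord_recr big_ord0 /= !mxE /=.
have r0 : u 0 0 ^+ 2 + u 0 1 ^+ 2 + 1 != 0.
  by rewrite gt_eqF// ltr_wpDl// addr_ge0// sqr_ge0.
by case: b; rewrite ?expr1 ?expr0; field.
Qed.

Definition stereo (b : bool) : chart R unit_sphere 2 :=
  Chart [set x : unit_sphere | (\val x : 'rV[R]_3) 0 ord_max != (-1) ^+ b]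
    (stereo_map b) (fun u => exist (fun x => x \in unit_sphere) _ (stereo_inv_subproof b u)).

Definition sphere2 : premanifold R :=
  @PreManifold R unit_sphere 2 (range stereo)
    (fun x => stereo (0 < (\val x : 'rV[R]_3) 0 ord_max)).

(* (u, v) |-> det (x; u; v), for x in S^2 and u, v in T_x S^2 <= R^3, which is
   the area form of the unit sphere oriented by its outward normal. *)
Definition sphere_area : form2 sphere2 := fun x =>
  let i : sphere2 -> euclid 3 := fun x => \val x in
  \matrix_(a, b)
    \det (col_mx (\val x : 'rV[R]_3) (col_mx (row a (mdiff i x)) (row b (mdiff i x)))
          : 'M[R]_3).

Definition sphere_line : premanifold R := prod_manifold sphere2 real_line.

Definition leaf_form (t : R) : form2 sphere2 :=
  fun x => (1 + t ^+ 2) *: sphere_area x.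

Definition leaf_incl (t : R) : sphere2 -> sphere_line := fun x => (x, t).

(* The Poisson structures on S^2 x R whose symplectic leaves are the spheres
   S^2 x {t} with the forms (1 + t^2) times the area form; these conditions
   determine q. *)
Definition has_sphere_leaves (q : bivector sphere_line) : Prop :=
  is_poisson q /\ forall t : R, symplectic_leaf q (leaf_form t) (leaf_incl t).

End SphereTimesLine.

(* Main.v *)
Require Import Defs.
From HB Require Import structures.
From mathcomp Require Import all_boot all_order all_algebra.
From mathcomp Require Import all_classical all_reals all_analysis.
From mathcomp Require Import ring lra.
Set Implicit Arguments.
Unset Strict Implicit.
Unset Printing Implicit Defensive.
Import Order.TTheory GRing.Theory Num.Theory.
Import numFieldNormedType.Exports.
Local Open Scope classical_set_scope.
Local Open Scope ring_scope.

(** The total space is M = (C^2 minus 0) x R, on which G = C^* acts by complex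
    multiplication of the first factor, and p : M -> S^2 x R is the Hopf map
    together with the coordinate t.  The form is exact,
      omega = d((2 (1 + t^2) eta + t rho) / |z|^2),
    where eta and rho are the imaginary and real parts of the Hermitian product of
    dz with z.

    One looks for omega in the shape (1 + t^2) p^*area + dt /\ alpha, which
    restricts to the leaf forms. Closedness then says that 2 t p^*area is
    exact on the slices of constant t; this excludes a trivial bundle, and it
    is what the Hopf bundle provides: on C^2 minus 0 the form p^*area is the
    differential of 2 eta / |z|^2, whence alpha = (4 t eta + rho) / |z|^2
    ([total_formE], [pullback_area], [total_form_split]).

    The summand rho / |z|^2 = d log |z| deals with the critical point of 1 +
    t^2 at t = 0: there the angular part 4 t eta of alpha vanishes, and
    without that summand dt would not be in the image of omega. The radial
    vector z is vertical and satisfies alpha(z) = 1 for every t. Hence, if i_X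
    omega = p^*b, contraction with it gives dt(X) = 0, so dp(X) is tangent to
    a leaf and is determined by the restriction of b to that leaf; conversely
    every covector b is attained after correcting X by a multiple of the
    radial vector ([linear_pushforward]). The same vector is the image of b
    under the Poisson structure ([sphere_leaves_sharp]), which is the forward
    Dirac property.

    M and G are open subsets of R^5 and R^2, with a single chart each, and all
    maps are rational in coordinates. Smoothness, Jacobians and d d = 0
    therefore reduce to a calculus of formal rational functions, and the
    geometric identities to identities in a field. *)

(** * Formal rational functions *)

Section RationalFunctions.
Context {R : realType} {n : nat}.

(** Every map in the construction is rational in the charts. Formal
    expressions make its derivatives computable: a derivative of an expression
    is again an expression, defined wherever the original one is, so that
    smoothness, Jacobians and the symmetry of second derivatives are all
    obtained by structural induction. *)
Inductive ratfun : Type :=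
| RCst of R
| RVar of 'I_n
| RAdd of ratfun & ratfun
| RMul of ratfun & ratfun
| RInv of ratfun.

Fixpoint reval (e : ratfun) (u : 'rV[R]_n) : R :=
  match e with
  | RCst c => c
  | RVar i => u 0 i
  | RAdd a b => reval a u + reval b u
  | RMul a b => reval a u * reval b u
  | RInv a => (reval a u)^-1
  end.

Fixpoint rdef (e : ratfun) (u : 'rV[R]_n) : bool :=
  match e with
  | RCst _ | RVar _ => true
  | RAdd a b | RMul a b => rdef a u && rdef b u
  | RInv a => rdef a u && (reval a u != 0)
  end.

Fixpoint rder (v : 'rV[R]_n) (e : ratfun) : ratfun :=
  match e with
  | RCst _ => RCst 0
  | RVar i => RCst (v 0 i)
  | RAdd a b => RAdd (rder v a) (rder v b)
  | RMul a b => RAdd (RMul (rder v a) b) (RMul a (rder v b))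
  | RInv a => RMul (RCst (- 1)) (RMul (rder v a) (RMul (RInv a) (RInv a)))
  end.

Lemma rdef_rder v e u : rdef e u -> rdef (rder v e) u.
Proof.
elim: e => //= [a IHa b IHb|a IHa b IHb|a IHa].
- by move=> /andP[/IHa-> /IHb->].
- by move=> /andP[da db]; rewrite IHa ?IHb ?da ?db.
- by move=> /andP[da a0]; rewrite IHa // da a0.
Qed.

(** The symmetry of second derivatives, on which the closedness of exact forms
    rests. *)
Lemma rderC v w e u : rdef e u ->
  reval (rder v (rder w e)) u = reval (rder w (rder v e)) u.
Proof.
elim: e => //= [a IHa b IHb|a IHa b IHb|a IHa].
- by move=> /andP[/IHa-> /IHb->].
- by move=> /andP[/IHa-> /IHb->]; ring.
- by move=> /andP[/IHa-> a0]; field.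
Qed.

Lemma reval_differentiable e u : rdef e u -> differentiable (reval e) u.
Proof.
elim: e => [c|i|a IHa b IHb|a IHa b IHb|a IHa] /=.
- by move=> _; exact: differentiable_cst.
- by move=> _; exact: differentiable_coord.
- by move=> /andP[/IHa da /IHb db]; exact: differentiableD.
- by move=> /andP[/IHa da /IHb db]; exact: differentiableM.
- by move=> /andP[/IHa da a0]; exact: differentiableV.
Qed.

Lemma derive_reval v e u : rdef e u -> 'D_v (reval e) u = reval (rder v e) u.
Proof.
elim: e => [c|i|a IHa b IHb|a IHa b IHb|a IHa] /=.
- by move=> _; exact: (derive_cst c).
- move=> _.
  transitivity (('D_v (id : 'rV[R]_n -> 'rV[R]_n) u) 0 i); last by rewrite derive_id.
  by rewrite derive_mx ?mxE//; exact: derivable_id.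
- move=> /andP[da db]; rewrite -IHa// -IHb//.
  by apply: deriveD; apply/diff_derivable/reval_differentiable.
- move=> /andP[da db]; rewrite -IHa// -IHb//.
  rewrite [LHS](deriveM (f := reval a) (g := reval b)); first last.
  + exact/diff_derivable/reval_differentiable.
  + exact/diff_derivable/reval_differentiable.
  by rewrite addrC /GRing.scale /= [reval b u * _]mulrC.
- move=> /andP[da a0]; rewrite -IHa//.
  rewrite [LHS](deriveV (f := reval a) a0); last first.
    exact/diff_derivable/reval_differentiable.
  by rewrite /GRing.scale /= expr2 invfM mulN1r mulNr mulrC.
Qed.

(** A denominator that is nonzero at a point is nonzero around it. *)
Lemma open_rdef e : open [set u | rdef e u].
Proof.
elim: e => [c|i|a IHa b IHb|a IHa b IHb|a IHa] /=.
- by rewrite (_ : [set _ | _] = setT); [exact: openT|apply/seteqP; split].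
- by rewrite (_ : [set _ | _] = setT); [exact: openT|apply/seteqP; split].
- rewrite (_ : [set _ | _] = [set u | rdef a u] `&` [set u | rdef b u]).
    exact: openI.
  by apply/seteqP; split => u /=; [move=> /andP|move=> [-> ->]].
- rewrite (_ : [set _ | _] = [set u | rdef a u] `&` [set u | rdef b u]).
    exact: openI.
  by apply/seteqP; split => u /=; [move=> /andP|move=> [-> ->]].
- rewrite openE => u /= /andP[da a0]; rewrite /interior.
  have ca := differentiable_continuous (reval_differentiable da).
  have n1 : \forall v \near u, rdef a v by exact: open_nbhs_nbhs (conj IHa da).
  have n2 : \forall v \near u, reval a v != 0.
    by apply: (ca [set x | x != 0]); apply: open_nbhs_nbhs; split.
  by near=> v; apply/andP; split; [near: v; exact: n1|near: v; exact: n2].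
Unshelve. all: by end_near. Qed.

End RationalFunctions.
Arguments ratfun : clear implicits.

(** * Rational maps between matrix spaces *)

(** The first order expansion of [f] at [x] is one of [g] as well. *)
Lemma near_eq_differentiable {R : realType} {V W : normedModType R}
    (f g : V -> W) x : (\near x, f x = g x) ->
  differentiable f x -> differentiable g x.
Proof.
move=> fg df.
have expand : g \o shift x = cst (g x) + 'd f x +o_ 0 id.
  apply/eqaddoP => _/posnumP[e].
  have /eqaddoP/(_ e%:num (gt0 _)) := diff_locally df.
  have fg0 : \forall h \near (0 : V), f (h + x) = g (h + x).
    by move: fg; rewrite (near_shift 0 x) subr0.
  apply: filterS2 fg0 => h /= fgh.
  by rewrite /cst !fctE /= fgh (nbhs_singleton fg).
apply/diff_locallyP.
suff -> : 'd g x = 'd f x :> (V -> W) by split => //; exact: diff_continuous.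
by apply: diff_unique => //; exact: diff_continuous.
Qed.

Section RationalMaps.
Context {R : realType} {n p q : nat}.
Implicit Types (U : set 'rV[R]_n) (f : 'rV[R]_n -> 'M[R]_(p, q)).
Implicit Types (e : 'I_p -> 'I_q -> ratfun R n).

(** The expressions are part of the data, because they are what gets
    differentiated; [f] may be arbitrary outside [U], as chart expressions
    are. *)
Definition rational_on U f e :=
  forall u i j, U u -> rdef (e i j) u /\ f u i j = reval (e i j) u.

Lemma rational_differentiable U f e u : open U -> rational_on U f e -> U u ->
  differentiable f u.
Proof.
move=> oU fe Uu.
pose g := \sum_(i < p) \sum_(j < q)
  (fun v : 'rV[R]_n => reval (e i j) v *: (delta_mx i j : 'M[R]_(p, q))).
apply: (@near_eq_differentiable _ _ _ g).
  apply: filterS (open_nbhs_nbhs (conj oU Uu)) => v Uv.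
  rewrite /g fct_sumE [RHS]matrix_sum_delta; apply: eq_bigr => i _.
  by rewrite fct_sumE; apply: eq_bigr => j _; rewrite (fe v i j Uv).2.
apply: differentiable_sum => i; apply: differentiable_sum => j.
exact/differentiableZl/reval_differentiable/(fe u i j Uu).1.
Qed.

Lemma derive_rational U f e v : open U -> rational_on U f e ->
  rational_on U ('D_v f) (fun i j => rder v (e i j)).
Proof.
move=> oU fe u i j Uu; have [de _] := fe u i j Uu.
split; first exact: rdef_rder.
rewrite derive_mx; last exact/diff_derivable/(rational_differentiable oU fe).
rewrite mxE -derive_reval//; apply: near_eq_derive.
by apply: filterS (open_nbhs_nbhs (conj oU Uu)) => w Uw; rewrite (fe w i j Uw).2.
Qed.

(** By [derive_rational] the class of maps that are rational on [U] is stable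
    under directional derivatives. *)
Lemma rational_smooth U f e : open U -> rational_on U f e -> smooth_on U f.
Proof.
move=> oU fe k; elim: k f e fe => [|k IHk] f e fe /=.
  by move=> u Uu; exact/differentiable_continuous/(rational_differentiable oU fe).
split; first by move=> u Uu; exact: (rational_differentiable oU fe).
by move=> v; exact: IHk (derive_rational v oU fe).
Qed.

End RationalMaps.

Lemma smooth_on_subset {R : realType} {V W : normedModType R} (U A : set V)
  (f : V -> W) : A `<=` U -> smooth_on U f -> smooth_on A f.
Proof.
move=> AU sf k; move: (sf k); elim: k f {sf} => [|k IHk] f /=.
  by move=> cf x /AU; exact: cf.
by move=> [df Df]; split=> [x /AU|v]; [exact: df|exact: IHk].
Qed.

(** Jacobians are used through their action on tangent vectors: this is a
    directional derivative, which [rder] computes for a vector with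
    indeterminate entries. *)
Lemma jacobian_rational {R : realType} {n q : nat} (U : set 'rV[R]_n)
    (f : 'rV[R]_n -> 'rV[R]_q) (e : 'I_1 -> 'I_q -> ratfun R n) u X j :
  open U -> rational_on U f e -> U u ->
  (X *m 'J f u) 0 j = reval (rder X (e 0 j)) u.
Proof.
move=> oU fe Uu.
rewrite -deriveEjacobian; last exact: (rational_differentiable oU fe).
by have [] := derive_rational X oU fe 0 j Uu.
Qed.

(** * Topology of matrix spaces and of their subsets *)

Section Topology.

Lemma continuous_mx {T : topologicalType} {R : realType} {p q : nat}
    (f : T -> 'M[R]_(p, q)) x :
  (forall i j, {for x, continuous (fun y => f y i j)}) -> {for x, continuous f}.
Proof.
move=> cf A [P fxP PA].
suff : \forall y \near x, forall ij : 'I_p * 'I_q, P ij.1 ij.2 (f y ij.1 ij.2).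
  by apply: filterS => y fyP; apply: PA => i j; exact: (fyP (i, j)).
by apply: filter_forall => -[i j]; exact: cf (fxP i j).
Qed.

Lemma continuous_coord {T : topologicalType} {R : realType} {p q : nat}
    (f : T -> 'M[R]_(p, q)) x i j :
  {for x, continuous f} -> {for x, continuous (fun y => f y i j)}.
Proof.
move=> cf A fA; apply: (cf [set N | A (N i j)]).
exact: (@coord_continuous _ _ _ i j (f x)).
Qed.

Lemma continuous_pairing {S T1 T2 : topologicalType} (f : S -> T1) (g : S -> T2)
    x : {for x, continuous f} -> {for x, continuous g} ->
  {for x, continuous (fun y => (f y, g y))}.
Proof. by move=> cf cg; apply: cvg_pair; [exact: cf|exact: cg]. Qed.

Lemma closed_eq_fun {S T : topologicalType} (f g : S -> T) : hausdorff_space T ->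
  continuous f -> continuous g -> closed [set x | f x = g x].
Proof.
move=> hT cf cg x clx; apply: hT => A B fA gB.
have fgAB : nbhs x (f @^-1` A `&` g @^-1` B).
  by apply: filterI; [exact: cf fA|exact: cg gB].
have [y [/= fgy [fAy gBy]]] := clx _ fgAB.
by exists (f y); split => //; rewrite fgy.
Qed.

Lemma continuous_row_mx {T : topologicalType} {R : realType} {p q r : nat}
    (f : T -> 'M[R]_(p, q)) (g : T -> 'M[R]_(p, r)) x :
  {for x, continuous f} -> {for x, continuous g} ->
  {for x, continuous (fun y => row_mx (f y) (g y))}.
Proof.
move=> cf cg; apply: continuous_mx => i j.
case: (split_ordP j) => k ->.
  rewrite (_ : (fun y => _) = fun y => f y i k).
    exact: continuous_coord.
  by apply/funext => y; rewrite row_mxEl.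
rewrite (_ : (fun y => _) = fun y => g y i k); first exact: continuous_coord.
by apply/funext => y; rewrite row_mxEr.
Qed.

Lemma continuous_set_val {T : topologicalType} (A : set T) :
  continuous (fun x : A => \val x).
Proof. exact: initial_continuous. Qed.

Lemma continuous_to_set_type {S T : topologicalType} (A : set T) (f : S -> A) x :
  {for x, continuous (fun y => \val (f y))} -> {for x, continuous f}.
Proof.
move=> cf B [_ [/= [W oW <-] Wfx] WB].
have fW : nbhs x [set y | W (\val (f y))].
  exact: cf (open_nbhs_nbhs (conj oW Wfx)).
by change (nbhs x (f @^-1` B)); apply: filterS fW => y Wy; exact: WB.
Qed.

Lemma set_type_hausdorff {T : topologicalType} (A : set T) :
  hausdorff_space T -> hausdorff_space A.
Proof.
move=> hT x y xy; apply: val_inj; apply: (hT (\val x) (\val y)) => B C Bx Cy.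
have [z [Bz Cz]] := xy _ _ (continuous_set_val Bx) (continuous_set_val Cy).
by exists (\val z).
Qed.

(** The traces of the boxes with rational corners form a basis. *)
Lemma set_type_second_countable {R : realType} {n : nat} (A : set 'rV[R]_n) :
  @second_countable A.
Proof.
pose box (q : 'M[rat * rat]_(1, n)) : set 'rV[R]_n :=
  [set u | forall j, ratr (q 0 j).1 < u 0 j < ratr (q 0 j).2].
pose boxA q : set A := [set x | box q (\val x)].
have obox q : open (box q).
  rewrite openE => u qu; rewrite /interior.
  exists (fun _ j => `]ratr (q 0 j).1, ratr (q 0 j).2[%classic) => [i j|v qv j].
    apply: open_nbhs_nbhs; split; first exact: interval_open.
    by rewrite ord1 /= in_itv /=; exact: qu.
  by have := qv 0 j; rewrite /= in_itv.
exists (range boxA); first exact: sub_countable (card_image_le _ _) (countableP _).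
split=> [_ [q _ <-]|x B [_ [/= [W oW <-] Wx] WB]].
  by exists (box q).
have [P xP PW] := open_nbhs_nbhs (conj oW Wx).
have rbox j : exists q : rat * rat,
    ratr q.1 < (\val x : 'rV[R]_n) 0 j < ratr q.2 /\
    `]ratr q.1, ratr q.2[%classic `<=` P 0 j.
  have /nbhs_ballP[e /= e0 eP] := xP 0 j.
  set c := (\val x : 'rV[R]_n) 0 j in eP *.
  have [q1 /[!in_itv]/= /andP[q1a q1b]] : exists q, ratr q \in `]c - e, c[.
    by apply: rat_in_itvoo; rewrite ltrBlDr ltrDl.
  have [q2 /[!in_itv]/= /andP[q2a q2b]] : exists q, ratr q \in `]c, c + e[.
    by apply: rat_in_itvoo; rewrite ltrDl.
  exists (q1, q2); rewrite /= q1b q2a; split=> // y /=.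
  rewrite in_itv /= => /andP[y1 y2]; apply: eP.
  rewrite /ball /= ltr_norml; apply/andP; split.
    by rewrite ltrBrDr addrC ltrBlDr (lt_trans y2).
  by rewrite ltrBlDr -ltrBlDl (lt_trans _ y1).
pose q : 'M[rat * rat]_(1, n) := \row_j sval (cid (rbox j)).
exists (boxA q).
  split; first by exists q.
  by move=> j; rewrite mxE; case: cid => ? [].
move=> y qy; apply: WB; apply: PW => i j; rewrite ord1.
move: (qy j); rewrite mxE; case: cid => /= q' [_ q'P] q'y.
by apply: q'P; rewrite /= in_itv.
Qed.

End Topology.

(** * Open subsets of R^n as manifolds *)

Section OpenSubmanifold.
Context {R : realType} {n : nat} (U : set 'rV[R]_n) (x0 : U).

(** Inverse charts are total functions, hence the default point [x0]. *)
Definition open_chart : chart R U n :=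
  Chart [set: U] (fun x => \val x) (insubd x0).

Definition open_submanifold : premanifold R :=
  @PreManifold R U n [set open_chart] (fun=> open_chart).

Hypothesis oU : open U.

Lemma open_chartK u : U u -> \val (insubd x0 u) = u.
Proof. by move=> Uu; rewrite val_insubd mem_set. Qed.

Lemma open_chart_img : chart_img open_chart = U.
Proof.
apply/seteqP; split => [_ [x _ <-]|u Uu]; first exact: set_valP.
by exists (insubd x0 u) => //; exact: open_chartK.
Qed.

Lemma open_chart_inv_continuous u : U u ->
  {for u, continuous (insubd x0 : 'rV[R]_n -> U)}.
Proof.
move=> Uu; apply: continuous_to_set_type => B.
rewrite /continuous_at open_chartK // => Bu.
rewrite nbhs_simpl /=; near=> v; rewrite /= open_chartK //.
  by near: v.
by near: v; exact: open_nbhs_nbhs.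
Unshelve. all: by end_near. Qed.

Lemma rational_id : rational_on U ((fun x : U => \val x) \o insubd x0)
  (fun _ j => RVar j).
Proof. by move=> u i j Uu; rewrite /= open_chartK // ord1. Qed.

Lemma open_submanifold_manifold : is_manifold open_submanifold.
Proof.
split.
- exact/set_type_hausdorff/norm_hausdorff.
- exact: set_type_second_countable.
- by [].
- move=> _ ->; split.
  + exact: openT.
  + by rewrite open_chart_img.
  + by move=> x _; exact: valKd.
  + by move=> x _; exact: continuous_set_val.
  + by move=> u; rewrite open_chart_img; exact: open_chart_inv_continuous.
- move=> _ _ -> ->; apply: smooth_on_subset (rational_smooth oU rational_id).
  by move=> _ [x _ <-]; exact: set_valP.
Qed.

End OpenSubmanifold.

(** * Exact 2-forms on open subsets of R^n *)

Section ExactForms.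
Context {R : realType} {n : nat} {U : set 'rV[R]_n} (x0 : U) (oU : open U).
Let M : premanifold R := open_submanifold x0.

Lemma open_form_in_chart (w : form2 M) u : U u ->
  form_in_chart (M := M) (open_chart x0) w u = w (insubd x0 u).
Proof.
move=> Uu; rewrite /form_in_chart /=.
suff -> : 'J ((fun x : U => \val x) \o insubd x0) u = 1%:M.
  by rewrite trmx1 mul1mx mulmx1.
apply/row_matrixP => i; rewrite !rowE; apply/rowP => j.
by rewrite (jacobian_rational _ _ oU (rational_id x0)) // mulmx1.
Qed.

Context (theta : 'rV[R]_n -> 'rV[R]_n) (e : 'I_n -> ratfun R n).
Hypothesis theta_e : rational_on U theta (fun _ => e).

(** [theta] is the row of coefficients of a 1-form and the entry (i, j) of its
    Jacobian is the i-th partial derivative of the j-th coefficient, so this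
    is the matrix of d theta. *)
Definition exterior_derivative : form2 M := fun z =>
  'J theta (\val z) - ('J theta (\val z))^T.

Let d i : 'rV[R]_n := delta_mx 0 i.

Lemma rational_exterior_derivative :
  rational_on U (form_in_chart (M := M) (open_chart x0) exterior_derivative)
    (fun i j => RAdd (rder (d i) (e j)) (RMul (RCst (- 1)) (rder (d j) (e i)))).
Proof.
move=> u i j Uu.
have dr k v : rdef (rder v (e k)) u by have [/rdef_rder] := theta_e 0 k Uu.
split; first by rewrite /= !dr.
have J k l : 'J theta u k l = reval (rder (d k) (e l)) u.
  rewrite -(jacobian_rational (d k) l oU theta_e Uu).
  by rewrite /d -rowE [RHS]mxE.
rewrite open_form_in_chart // /exterior_derivative open_chartK //.
by rewrite mxE [X in _ + X]mxE [X in _ - X]mxE !J /= mulN1r.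
Qed.

(** The identity d d = 0: the six second derivatives cancel in pairs by
    [rderC]. *)
Lemma exterior_derivative_presymplectic : presymplectic exterior_derivative.
Proof.
have img : chart_img (open_chart x0) = U by exact: open_chart_img.
split; first split.
- by move=> z; apply/matrixP => i j; rewrite !mxE opprB.
- move=> _ ->; rewrite [chart_img _]img.
  exact: rational_smooth oU rational_exterior_derivative.
- move=> _ u i j k -> + wc; rewrite [chart_img _]img => Uu.
  have D l a b : partial l (wc a b) u =
      reval (rder (d l) (rder (d a) (e b))) u -
      reval (rder (d l) (rder (d b) (e a))) u.
    have dw := (rational_exterior_derivative a b Uu).1.
    rewrite /partial /wc.
    transitivity ('D_(d l) (reval (RAdd (rder (d a) (e b))
      (RMul (RCst (- 1)) (rder (d b) (e a))))) u).
      apply: near_eq_derive.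
      apply: filterS (open_nbhs_nbhs (conj oU Uu)) => v Uv.
      exact: (rational_exterior_derivative a b Uv).2.
    by rewrite derive_reval //= mul0r add0r mulN1r.
  have de a : rdef (e a) u by exact: (theta_e 0 a Uu).1.
  rewrite !D (rderC (d i) (d j)) // (rderC (d j) (d k)) // (rderC (d k) (d i)) //.
  ring.
Qed.

End ExactForms.

(** * Coordinates *)

Declare Scope ratfun_scope.
Delimit Scope ratfun_scope with F.
Bind Scope ratfun_scope with ratfun.
Notation "x + y" := (RAdd x y) : ratfun_scope.
Notation "x * y" := (RMul x y) : ratfun_scope.
Notation "x - y" := (RAdd x (RMul (RCst (- 1)) y)) : ratfun_scope.
Notation "- x" := (RMul (RCst (- 1)) x) : ratfun_scope.
Notation "x / y" := (RMul x (RInv y)) : ratfun_scope.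
(* The bidirectionality hints let the size of the index type be read off the
   expected type in the coordinate notations below. *)
Arguments Ordinal {n} & {m} _.
Arguments RVar {R n} & _.
Arguments RAdd {R n} & _ _.
Arguments RMul {R n} & _ _.
Arguments RInv {R n} & _.
Notation "''c_' k" := (@Ordinal _ k isT) (at level 8, k at level 0).
Notation "u # k" := (fun_of_matrix u (0 : 'I_1) (@Ordinal _ k isT))
  (at level 8, k at level 0).
Notation "''x_' k" := (RVar (@Ordinal _ k isT)) (at level 8, k at level 0).

Lemma ord5P (P : 'I_5 -> Prop) :
  P (@Ordinal 5 0 isT) -> P (@Ordinal 5 1 isT) -> P (@Ordinal 5 2 isT) ->
  P (@Ordinal 5 3 isT) -> P (@Ordinal 5 4 isT) -> forall i, P i.
Proof.
move=> P0 P1 P2 P3 P4 [[|[|[|[|[|//]]]]] i5];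
  by rewrite (bool_irrelevance i5 isT).
Qed.

Lemma ord2P (P : 'I_2 -> Prop) :
  P (@Ordinal 2 0 isT) -> P (@Ordinal 2 1 isT) -> forall i, P i.
Proof. by move=> P0 P1 [[|[|//]] i2]; rewrite (bool_irrelevance i2 isT). Qed.

Lemma row2_eq {R : realType} (u v : 'rV[R]_2) :
  u#0 = v#0 -> u#1 = v#1 -> u = v.
Proof. by move=> e0 e1; apply/rowP; apply: ord2P. Qed.

Lemma row5_eq {R : realType} (u v : 'rV[R]_5) :
  u#0 = v#0 -> u#1 = v#1 -> u#2 = v#2 -> u#3 = v#3 -> u#4 = v#4 -> u = v.
Proof. by move=> *; apply/rowP; apply: ord5P. Qed.

Lemma sum_ord5 {R : realType} (F : 'I_5 -> R) : \sum_i F i =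
  F (@Ordinal 5 0 isT) + F (@Ordinal 5 1 isT) + F (@Ordinal 5 2 isT) +
  F (@Ordinal 5 3 isT) + F (@Ordinal 5 4 isT).
Proof.
rewrite !big_ord_recr big_ord0 /= add0r.
by do ! congr (_ + _); congr F; apply: val_inj.
Qed.

(** * The group of nonzero complex numbers *)

Section CStar.
Context {R : realType}.
Implicit Types g h : 'rV[R]_2.

Definition norm2 g : R := g#0 * g#0 + g#1 * g#1.

Definition cstar_set : set 'rV[R]_2 := [set g | norm2 g != 0].

Definition cmul g h : 'rV[R]_2 :=
  \row_i [:: g#0 * h#0 - g#1 * h#1; g#0 * h#1 + g#1 * h#0]`_i.

Definition cinv g : 'rV[R]_2 :=
  \row_i [:: g#0 / norm2 g; - g#1 / norm2 g]`_i.

Definition cunit : 'rV[R]_2 := \row_i [:: 1; 0]`_i.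

Lemma norm2_cmul g h : norm2 (cmul g h) = norm2 g * norm2 h.
Proof. by rewrite /norm2 !mxE /=; ring. Qed.

Lemma norm2_cunit : norm2 cunit = 1.
Proof. by rewrite /norm2 !mxE /=; ring. Qed.

Lemma norm2_cinv g : norm2 g != 0 -> norm2 (cinv g) = (norm2 g)^-1.
Proof. by rewrite /norm2 !mxE /= => g0; rewrite /norm2; field. Qed.

Lemma cstar_norm2 (g : cstar_set) : norm2 (\val g) != 0.
Proof. exact: (set_valP g). Qed.

Lemma cmul_subproof (g h : cstar_set) : cmul (\val g) (\val h) \in cstar_set.
Proof.
by apply/mem_set; rewrite /cstar_set /= norm2_cmul mulf_neq0 // cstar_norm2.
Qed.

Lemma cinv_subproof (g : cstar_set) : cinv (\val g) \in cstar_set.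
Proof.
apply/mem_set; rewrite /cstar_set /= norm2_cinv ?invr_neq0 //;
  exact: cstar_norm2.
Qed.

Lemma cunit_subproof : cunit \in cstar_set.
Proof. by apply/mem_set; rewrite /cstar_set /= norm2_cunit oner_neq0. Qed.

Definition cstar_one : cstar_set :=
  exist (fun x => x \in cstar_set) cunit cunit_subproof.
Definition cstar_mul (g h : cstar_set) : cstar_set :=
  exist (fun x => x \in cstar_set) _ (cmul_subproof g h).
Definition cstar_inv (g : cstar_set) : cstar_set :=
  exist (fun x => x \in cstar_set) _ (cinv_subproof g).

Lemma open_cstar : open cstar_set.
Proof. exact: (@open_rdef R 2 (RInv ('x_0 * 'x_0 + 'x_1 * 'x_1)%F)). Qed.

Definition cstar : premanifold R := open_submanifold cstar_one.

Lemma cstar_mulA : associative cstar_mul.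
Proof. by move=> g h k; apply: val_inj; apply: row2_eq; rewrite /= !mxE /=; ring. Qed.

Lemma cstar_mul1 : left_id cstar_one cstar_mul.
Proof. by move=> g; apply: val_inj; apply: row2_eq; rewrite /= !mxE /=; ring. Qed.

Lemma cstar_mulV : left_inverse cstar_one cstar_inv cstar_mul.
Proof.
move=> g; apply: val_inj.
have := cstar_norm2 g; rewrite /norm2 => g0.
by apply: row2_eq; rewrite /= !mxE /= /norm2; field.
Qed.

End CStar.

(** * Rational maps between open subsets *)

Lemma rational_comp_continuous {R : realType} {T : topologicalType} {m n : nat}
    (phi : T -> 'rV[R]_m) (f : T -> 'rV[R]_n) (e : 'I_n -> ratfun R m) :
  continuous phi ->
  (forall x j, rdef (e j) (phi x) /\ f x 0 j = reval (e j) (phi x)) ->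
  continuous f.
Proof.
move=> cphi fe x; apply: continuous_mx => i j.
rewrite (_ : (fun y => _) = reval (e j) \o phi).
  apply: continuous_comp; first exact: cphi.
  exact/differentiable_continuous/reval_differentiable/(fe x j).1.
by apply/funext => y; rewrite ord1 (fe y j).2.
Qed.

Lemma rational_continuous {R : realType} {T : topologicalType} {m n : nat}
    (phi : T -> 'rV[R]_m) (V : set 'rV[R]_n) (f : T -> V)
    (e : 'I_n -> ratfun R m) :
  continuous phi ->
  (forall x j, rdef (e j) (phi x) /\
     (\val (f x) : 'rV[R]_n) 0 j = reval (e j) (phi x)) ->
  continuous f.
Proof.
move=> cphi fe x; apply: continuous_to_set_type.
exact: (rational_comp_continuous cphi fe).
Qed.

Section RationalMorphisms.
Context {R : realType} {m n p : nat}.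
Context {U : set 'rV[R]_m} {V : set 'rV[R]_n} {W : set 'rV[R]_p}.
Context (x0 : U) (y0 : V) (z0 : W).
Hypotheses (oU : open U) (oV : open V).

Let M : premanifold R := open_submanifold x0.
Let N : premanifold R := open_submanifold y0.
Let P : premanifold R := open_submanifold z0.

Lemma rational_smooth_map (f : U -> W) (e : 'I_p -> ratfun R m) :
  (forall x j, rdef (e j) (\val x) /\
     (\val (f x) : 'rV[R]_p) 0 j = reval (e j) (\val x)) ->
  smooth_map (f : M -> P).
Proof.
move=> fe; split; first exact: rational_continuous (@continuous_set_val _ _) fe.
move=> _ _ -> ->.
apply: (@smooth_on_subset _ _ _ U).
  by move=> _ [x _ <-]; exact: set_valP.
apply: (rational_smooth (e := fun _ => e)) => // u i j Uu.
by have := fe (insubd x0 u) j; rewrite open_chartK // ord1.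
Qed.

Lemma rational_smooth_map2 (f : U * V -> W) (e : 'I_p -> ratfun R (m + n)) :
  (forall z j, rdef (e j) (row_mx (\val z.1) (\val z.2)) /\
     (\val (f z) : 'rV[R]_p) 0 j = reval (e j) (row_mx (\val z.1) (\val z.2))) ->
  @smooth_map R (prod_manifold M N) P f.
Proof.
move=> fe; split.
  apply: (@rational_continuous _ (U * V)%type _ _
    (fun z => row_mx (\val z.1) (\val z.2)) _ _ e _ fe) => z.
  apply: (continuous_row_mx (T := (U * V)%type) (f := fun z => \val z.1)
    (g := fun z => \val z.2)).
    apply: (continuous_comp (f := fst)); first exact: cvg_fst.
    exact: continuous_set_val.
  apply: (continuous_comp (f := snd)); first exact: cvg_snd.
  exact: continuous_set_val.
move=> _ _ [_ -> [_ -> <-]] ->.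
pose UV := [set u : 'rV[R]_(m + n) | U (lsubmx u) /\ V (rsubmx u)].
have oUV : open UV.
  apply: openI.
    by apply: open_comp => // u _; exact: continuous_lsubmx.
  by apply: open_comp => // u _; exact: continuous_rsubmx.
apply: (@smooth_on_subset _ _ _ UV).
  move=> _ [z _ <-]; split; rewrite /= ?row_mxKl ?row_mxKr; exact: set_valP.
apply: (rational_smooth (e := fun _ => e)) => // u i j [Uu Vu].
have := fe (insubd x0 (lsubmx u), insubd y0 (rsubmx u)) j.
by rewrite !open_chartK // hsubmxK ord1.
Qed.

End RationalMorphisms.

Section CStarGroup.
Context {R : realType}.

Lemma cstar_mul_smooth : @smooth_map R (prod_manifold cstar cstar) cstar
  (fun z => cstar_mul z.1 z.2).
Proof.
pose g k : ratfun R (2 + 2) := RVar (lshift 2 k).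
pose h k : ratfun R (2 + 2) := RVar (rshift 2 k).
pose e (j : 'I_2) : ratfun R (2 + 2) := (nth (RCst 0)
  [:: g 'c_0 * h 'c_0 - g 'c_1 * h 'c_1;
      g 'c_0 * h 'c_1 + g 'c_1 * h 'c_0] j)%F.
apply: (rational_smooth_map2 cstar_one cstar_one cstar_one open_cstar
  open_cstar (e := e)).
move=> z; apply: ord2P; split => //; rewrite /= !row_mxEl !row_mxEr !mxE /=;
  by rewrite ?mulN1r.
Qed.

Lemma cstar_inv_smooth : @smooth_map R _ _ (cstar_inv : cstar -> cstar).
Proof.
pose g k : ratfun R 2 := RVar k.
pose N := (g 'c_0 * g 'c_0 + g 'c_1 * g 'c_1)%F.
pose e (j : 'I_2) : ratfun R 2 := (nth (RCst 0)
  [:: g 'c_0 / N; (- g 'c_1) / N] j)%F.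
apply: (rational_smooth_map cstar_one cstar_one open_cstar (e := e)).
move=> z; apply: ord2P; split; rewrite /= ?mxE /= ?mulN1r //; exact: (cstar_norm2 z).
Qed.

Definition cstar_group : lie_group R :=
  @LieGroup R cstar cstar_mul cstar_one cstar_inv
    (open_submanifold_manifold _ open_cstar) cstar_mulA cstar_mul1 cstar_mulV
    cstar_mul_smooth cstar_inv_smooth.
End CStarGroup.

(** * The presymplectic manifold *)

Section TotalSpace.
Context {R : realType}.
Implicit Types (g : 'rV[R]_2) (u X Y : 'rV[R]_5).

(** A point (a, b, c, d, t) of R^5 stands for (z1, z2, t) in C^2 x R with z1 =
    a + i b and z2 = c + i d. *)
Definition normz1 u : R := u#0 * u#0 + u#1 * u#1.
Definition normz2 u : R := u#2 * u#2 + u#3 * u#3.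
Definition normz u : R := normz1 u + normz2 u.

Definition total_set : set 'rV[R]_5 := [set u | normz u != 0].

Let x (k : 'I_5) : ratfun R 5 := RVar k.
Let a := x 'c_0.
Let b := x 'c_1.
Let c := x 'c_2.
Let d := x 'c_3.
Let t := x 'c_4.
Let one : ratfun R 5 := RCst 1.
Let r := (a * a + b * b + (c * c + d * d))%F.

Lemma normz_neq0 (z : total_set) : normz (\val z) != 0.
Proof. exact: (set_valP z). Qed.

Lemma open_total : open total_set.
Proof. exact: (@open_rdef R 5 (RInv r)). Qed.

Definition base_point : 'rV[R]_5 := \row_i [:: 1; 0; 0; 0; 0]`_i.

Lemma base_point_subproof : base_point \in total_set.
Proof.
apply/mem_set; rewrite /total_set /normz /normz1 /normz2 /= !mxE /=.
by rewrite !mulr0 mulr1 !addr0 oner_neq0.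
Qed.

Definition total_base : total_set :=
  exist (fun x => x \in total_set) _ base_point_subproof.

Definition total_space : premanifold R := open_submanifold total_base.

(** The 1-form (2 (1 + t^2) eta + t rho) / |z|^2, where eta and rho are the
    forms [angular_form] and [radial_form] below. The differential of 2 eta /
    |z|^2 is the pull-back of the area form of the sphere, and rho / |z|^2 is
    d log |z|. *)
Definition potential_coef (j : 'I_5) : ratfun R 5 :=
  nth (RCst 0) [:: (t * a - (RCst 2) * (one + t * t) * b) / r;
                   (t * b + (RCst 2) * (one + t * t) * a) / r;
                   (t * c - (RCst 2) * (one + t * t) * d) / r;
                   (t * d + (RCst 2) * (one + t * t) * c) / r]%F j.

Definition potential u : 'rV[R]_5 := \row_j reval (potential_coef j) u.

Lemma rational_potential : rational_on total_set potential (fun _ => potential_coef).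
Proof.
move=> u i j; rewrite ord1 /total_set /= => u0; split; last by rewrite mxE.
by move: j; apply: ord5P => //=; rewrite u0.
Qed.

Definition total_form : form2 total_space :=
  @exterior_derivative R 5 total_set total_base potential.

Lemma total_form_presymplectic : presymplectic total_form.
Proof.
exact (exterior_derivative_presymplectic total_base open_total
  rational_potential).
Qed.

(** The real and imaginary parts of z2 dz1 - z1 dz2, the 1-form on C^2 that
    vanishes on the complex line through (z1, z2). *)
Definition phi1 u X : R :=
  (u#2 * X#0 - u#3 * X#1) - (u#0 * X#2 - u#1 * X#3).
Definition phi2 u X : R :=
  (u#2 * X#1 + u#3 * X#0) - (u#0 * X#3 + u#1 * X#2).

(** The imaginary and real parts of the Hermitian product of dz with z: they
    measure the components of X along i z and along z, which span the complex
    line through z. *)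
Definition angular_form u X : R := u#0 * X#1 - u#1 * X#0 + u#2 * X#3 - u#3 * X#2.
Definition radial_form u X : R := u#0 * X#0 + u#1 * X#1 + u#2 * X#2 + u#3 * X#3.

Definition alpha u X : R := (4 * u#4 * angular_form u X + radial_form u X) / normz u.

(** Here (4 / |z|^4) phi1 /\ phi2 is the differential of 2 eta / |z|^2, the
    form rho / |z|^2 is closed, and alpha consists of the t-derivatives of the
    coefficients of the potential. *)
Lemma total_formE (z : total_set) X Y (u := \val z) :
  (X *m total_form z *m Y^T) 0 0 =
  4 * (1 + u#4 * u#4) / (normz u * normz u) *
    (phi1 u X * phi2 u Y - phi1 u Y * phi2 u X)
  + X#4 * alpha u Y - Y#4 * alpha u X.
Proof.
have u0 : normz u != 0 := normz_neq0 z.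
have J V W : (V *m 'J potential u *m W^T) 0 0 =
    \sum_j reval (rder V (potential_coef j)) u * W 0 j.
  rewrite mxE; apply: eq_bigr => j _; rewrite [W^T _ _]mxE.
  by rewrite (jacobian_rational _ _ open_total rational_potential).
have -> : (X *m total_form z *m Y^T) 0 0 =
    (X *m 'J potential u *m Y^T) 0 0 - (Y *m 'J potential u *m X^T) 0 0.
  rewrite /total_form /exterior_derivative mulmxBr mulmxBl [LHS]mxE; congr (_ + _).
  rewrite [LHS]mxE; congr (- _).
  have scalar_tr (A : 'M[R]_1) : A 0 0 = A^T 0 0 by rewrite mxE.
  by rewrite scalar_tr !trmx_mul !trmxK mulmxA.
rewrite !J !sum_ord5 /= /alpha /phi1 /phi2 /angular_form /radial_form.
move: u0; rewrite /normz /normz1 /normz2 => u0.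
by field.
Qed.

End TotalSpace.

(** * The area form in stereographic charts *)

Section Sphere.
Context {R : realType}.

Lemma det_rows3 (x y z : 'rV[R]_3) :
  \det (col_mx x (col_mx y z) : 'M[R]_3) =
  x#0 * (y#1 * z#2 - y#2 * z#1) - x#1 * (y#0 * z#2 - y#2 * z#0)
  + x#2 * (y#0 * z#1 - y#1 * z#0).
Proof.
have e (A : 'M[R]_3) : \det A =
   A 'c_0 'c_0 * (A 'c_1 'c_1 * A 'c_2 'c_2 - A 'c_1 'c_2 * A 'c_2 'c_1)
   - A 'c_0 'c_1 * (A 'c_1 'c_0 * A 'c_2 'c_2 - A 'c_1 'c_2 * A 'c_2 'c_0)
   + A 'c_0 'c_2 * (A 'c_1 'c_0 * A 'c_2 'c_1 - A 'c_1 'c_1 * A 'c_2 'c_0).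
  pose m (i j : nat) := A (inord i) (inord j).
  have mE i j : A i j = m i j by rewrite /m !inord_val.
  rewrite (expand_det_row _ ord0) !big_ord_recr big_ord0 /= /cofactor.
  do ! rewrite (expand_det_row _ ord0) !big_ord_recr big_ord0 /= /cofactor.
  rewrite !det_mx00 !mxE !mE /= /bump /=.
  rewrite !expr0 !expr1 ?expr2.
  by ring.
rewrite e.
have r0 : @Ordinal 3 0 isT = lshift 2 (0 : 'I_1) by exact: val_inj.
have r1 : @Ordinal 3 1 isT = rshift 1 (lshift 1 (0 : 'I_1)) by exact: val_inj.
have r2 : @Ordinal 3 2 isT = rshift 1 (rshift 1 (0 : 'I_1)) by exact: val_inj.
have row0 j : (col_mx x (col_mx y z) : 'M[R]_3) 'c_0 j = x 0 j.
  by rewrite r0 (@col_mxEu _ 1 2).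
have row1 j : (col_mx x (col_mx y z) : 'M[R]_3) 'c_1 j = y 0 j.
  by rewrite r1 (@col_mxEd _ 1 2) (@col_mxEu _ 1 1).
have row2 j : (col_mx x (col_mx y z) : 'M[R]_3) 'c_2 j = z 0 j.
  by rewrite r2 (@col_mxEd _ 1 2) (@col_mxEd _ 1 1).
rewrite !row0 !row1 !row2; ring.
Qed.

Lemma sum_sqr_add1_neq0 (p q : R) : p * p + q * q + 1 != 0.
Proof. by rewrite gt_eqF // ltr_wpDl // addr_ge0 // -expr2 sqr_ge0. Qed.

Lemma stereo_inv_rational b : rational_on setT (@stereo_inv_val R b)
  (fun _ j => let u k : ratfun R 2 := RVar k in
    let r := (u 'c_0 * u 'c_0 + u 'c_1 * u 'c_1)%F in
    nth (RCst 0) [:: (RCst 2 * u 'c_0) / (r + RCst 1);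
                     (RCst 2 * u 'c_1) / (r + RCst 1);
                     (RCst ((-1) ^+ b) * (r - RCst 1)) / (r + RCst 1)]%F j).
Proof.
move=> u i j _.
have r0 := sum_sqr_add1_neq0 (u#0) (u#1).
have e0 : (0 : 'I_2) = @Ordinal 2 0 isT by apply: val_inj.
have e1 : (1 : 'I_2) = @Ordinal 2 1 isT by apply: val_inj.
rewrite ord1 /stereo_inv_val mxE /= !expr2 !e0 !e1.
case: j => [[|[|[|//]]] j3] /=; rewrite r0; split => //.
by rewrite mulN1r.
Qed.

(** The preferred chart at v is [stereo (is_north v)]. *)
Definition is_north (v : 'rV[R]_3) : bool := 0 < v 0 ord_max.

Lemma is_northP (v : 'rV[R]_3) : v 0 ord_max != (-1) ^+ is_north v.
Proof.
rewrite /is_north; case: ltP => [v0|v0]; rewrite ?expr0 ?expr1.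
  by rewrite gt_eqF // (lt_trans _ v0) // oppr_lt0.
by rewrite lt_eqF // (le_lt_trans v0).
Qed.

(** The area form of the chart [stereo b] is this multiple of du0 /\ du1. The
    sign is negative for [b = false], because projection from the north pole
    reverses the orientation by the outward normal. *)
Definition area_density (u : 'rV[R]_2) (b : bool) : R :=
  let r := u#0 * u#0 + u#1 * u#1 + 1 in - (-1) ^+ b * 4 / (r * r).

Lemma stereo_mapK (b : bool) (y : sphere2 R) :
  (\val y : 'rV[R]_3) 0 ord_max != (-1) ^+ b ->
  stereo_inv_val b (stereo_map b y) = \val y.
Proof.
move=> yb.
have : \sum_i (\val y : 'rV[R]_3) 0 i ^+ 2 = 1 by exact: (set_valP y).
set v := (\val y : 'rV[R]_3) in yb *.
rewrite !big_ord_recr big_ord0 /= add0r.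
set s : R := (-1) ^+ b in yb *.
have s2 : s * s = 1 by rewrite /s; case: (b); rewrite ?expr0 ?expr1; ring.
rewrite (_ : widen_ord _ (widen_ord _ _) = 0); last exact: val_inj.
rewrite (_ : widen_ord _ _ = 1); last exact: val_inj.
move=> y1.
set w := 1 - s * v 0 ord_max.
have w0 : w != 0.
  apply: contra yb => /eqP w0; rewrite -subr_eq0 -[X in X - _]mul1r -s2.
  by rewrite -mulrA -[X in _ - X]mulr1 -mulrBr -opprB mulrN -/w w0 mulr0 oppr0.
have r1 : (v 0 0 / w) ^+ 2 + (v 0 1 / w) ^+ 2 = 2 / w - 1.
  rewrite !expr_div_n -mulrDl.
  have -> : v 0 0 ^+ 2 + v 0 1 ^+ 2 = (2 - w) * w.
    apply: (addIr (v 0 ord_max ^+ 2)); rewrite y1.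
    transitivity (1 + (1 - s * s) * v 0 ord_max ^+ 2); last by rewrite /w; ring.
    by rewrite s2 subrr mul0r addr0.
  by field.
apply/rowP => j; rewrite /stereo_inv_val mxE /stereo_map !mxE /= -/v -/s -/w r1
  subrK invf_div.
have e2 : (2 / w - 1 - 1) = 2 * s * v 0 ord_max / w.
  by rewrite /w; field; rewrite -/w.
case: j => [[|[|[|//]]] j3] /=.
- rewrite (_ : Ordinal j3 = 0); last exact: val_inj.
  by field.
- rewrite (_ : Ordinal j3 = 1); last exact: val_inj.
  by field.
- rewrite (_ : Ordinal j3 = ord_max); last exact: val_inj.
  rewrite e2 (_ : s * _ = s * s * (2 * v 0 ord_max / w)); last by ring.
  by rewrite s2; field.
Qed.

Lemma sphere_areaE (y : sphere2 R) (b := is_north (\val y)) k l :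
  sphere_area y k l = area_density (stereo_map b y) b *
    (((k == 'c_0) && (l == 'c_1))%:R - ((k == 'c_1) && (l == 'c_0))%:R).
Proof.
rewrite mulrBr.
set u0 := stereo_map b y.
have yE : (\val y : 'rV[R]_3) = stereo_inv_val b u0.
  rewrite -(stereo_mapK (b := b)) //; exact: is_northP.
pose i : sphere2 R -> euclid R 3 := fun x => \val x.
have J X j := jacobian_rational X j openT (@stereo_inv_rational b)
  (I : [set: 'rV[R]_2] u0).
have D : mdiff i y = 'J (@stereo_inv_val R b) u0 by [].
have V j := (@stereo_inv_rational b u0 0 j I).2.
clearbody u0.
have r0 := sum_sqr_add1_neq0 (u0#0) (u0#1).
rewrite /sphere_area mxE det_rows3 yE -/i D !rowE !J !V /area_density.
set s : R := (-1) ^+ b; clearbody s.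
move: k l; apply: ord2P; apply: ord2P; rewrite /= !mxE /=;
  move: r0; set p := u0#0; set q := u0#1; clearbody p q => r0.
- by rewrite !mulr0 subr0; ring.
- rewrite !(mul0r, mulr0, mul1r, mulr1, addr0, add0r, subr0).
  by field; exact: r0.
- rewrite !(mul0r, mulr0, mul1r, mulr1, addr0, add0r, subr0).
  by field; exact: r0.
- by rewrite !mulr0 subr0; ring.
Qed.

Lemma sphere_area_bilinear (y : sphere2 R) (b := is_north (\val y)) u v :
  (u *m sphere_area y *m v^T) 0 0 =
  area_density (stereo_map b y) b * (u#0 * v#1 - u#1 * v#0).
Proof.
rewrite mxE !big_ord_recr big_ord0 /= add0r !mxE.
rewrite !big_ord_recr !big_ord0 /= !add0r !sphere_areaE /=.
rewrite (_ : widen_ord _ _ = @Ordinal 2 0 isT); last exact: val_inj.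
rewrite (_ : ord_max = @Ordinal 2 1 isT); last exact: val_inj.
by rewrite /=; ring.
Qed.

Lemma area_density_neq0 u b : area_density u b != 0.
Proof.
rewrite /area_density mulf_neq0 ?invr_neq0 ?mulf_neq0 ?sum_sqr_add1_neq0 //.
by rewrite oppr_eq0 signr_eq0.
Qed.

Lemma sphere_area_unit (y : sphere2 R) : sphere_area y \in unitmx.
Proof.
set k := area_density (stereo_map (is_north (\val y)) y) (is_north (\val y)).
have k0 : k != 0 by exact: area_density_neq0.
suff /mulmx1_unit[] : sphere_area y *m (- (k * k)^-1 *: sphere_area y) = 1%:M by [].
rewrite -scalemxAr; apply/matrixP => i j.
rewrite !mxE !big_ord_recr big_ord0 /= !sphere_areaE -/k.
rewrite (_ : widen_ord _ _ = @Ordinal 2 0 isT); last exact: val_inj.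
rewrite (_ : ord_max = @Ordinal 2 1 isT); last exact: val_inj.
by move: i j; apply: ord2P; apply: ord2P; rewrite /=; field.
Qed.

End Sphere.

(** * The Hopf map *)

Section Hopf.
Context {R : realType}.
Implicit Types (u X Y : 'rV[R]_5) (z : total_set (R := R)).

(** The point (2 z2 conj(z1), |z1|^2 - |z2|^2) / |z|^2 of C x R. It is the
    conjugation of z1 rather than z2 that makes the pull-back of the area form
    a positive multiple of phi1 /\ phi2. *)
Definition hopf_val u : 'rV[R]_3 :=
  coord3 (2 * (u#0 * u#2 + u#1 * u#3) / normz u)
         (2 * (u#0 * u#3 - u#1 * u#2) / normz u)
         ((normz1 u - normz2 u) / normz u).

Lemma hopf_subproof z : hopf_val (\val z) \in unit_sphere (R := R).
Proof.
have u0 := normz_neq0 z.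
apply/mem_set; rewrite /unit_sphere /= !big_ord_recr big_ord0 /= !mxE /=.
by move: u0; rewrite /normz /normz1 /normz2 => u0; field.
Qed.

Definition hopf z : unit_sphere (R := R) :=
  exist (fun v => v \in unit_sphere (R := R)) _ (hopf_subproof z).

Definition hopf_proj z : sphere_line R := (hopf z, (\val z : 'rV[R]_5)#4).

(** The chart [stereo true] turns the Hopf map into z2 / z1 and [stereo false]
    into conj(z1 / z2); [affine_norm b] is the squared modulus of the
    denominator, and [affine_set b] the domain of the corresponding affine
    coordinate of the projective line. *)
Definition affine_norm (b : bool) u := if b then normz1 u else normz2 u.

Definition affine_set b : set 'rV[R]_5 := [set u | affine_norm b u != 0].

Let x (k : 'I_5) : ratfun R 5 := RVar k.
Let affine_normF (b : bool) : ratfun R 5 :=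
  (if b then x 'c_0 * x 'c_0 + x 'c_1 * x 'c_1
   else x 'c_2 * x 'c_2 + x 'c_3 * x 'c_3)%F.

Definition proj_coef b (j : 'I_3) : ratfun R 5 :=
  nth (RCst 0) [:: (x 'c_0 * x 'c_2 + x 'c_1 * x 'c_3) / affine_normF b;
                   (x 'c_0 * x 'c_3 - x 'c_1 * x 'c_2) / affine_normF b;
                   x 'c_4]%F j.

Lemma open_affine b : open (affine_set b).
Proof.
case: b; first exact: (@open_rdef R 5 (RInv (affine_normF true))).
exact: (@open_rdef R 5 (RInv (affine_normF false))).
Qed.

Lemma sum_sqr_eq0 (p q r s : R) :
  p * p + q * q + (r * r + s * s) = 0 -> p * p + q * q = 0.
Proof. by move=> e; nra. Qed.

Lemma affine_total b : affine_set b `<=` total_set.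
Proof.
move=> u; rewrite /affine_set /total_set /normz /=.
apply: contra => /eqP e; rewrite /affine_norm; case: b.
  by apply/eqP; exact: sum_sqr_eq0 e.
by move: e; rewrite addrC => /sum_sqr_eq0 /eqP.
Qed.

Lemma affine_of_hopf (b : bool) z :
  (\val (hopf z) : 'rV[R]_3) 0 ord_max != (-1) ^+ b -> affine_set b (\val z).
Proof.
have u0 := normz_neq0 z.
apply: contra; rewrite mxE /= => /eqP.
move: u0; rewrite /affine_norm /normz; case: b => u0 e; move: u0; rewrite e.
  by rewrite sub0r add0r => u0; rewrite mulNr divff // expr1.
by rewrite subr0 addr0 => u0; rewrite divff // expr0.
Qed.

Lemma stereo_hopf b z : affine_set b (\val z) ->
  stereo_map b (hopf z) =
    \row_j reval (proj_coef b (widen_ord (leqnSn 2) j)) (\val z).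
Proof.
move=> zb; have u0 := normz_neq0 z.
set u : 'rV[R]_5 := \val z in u0 zb *.
rewrite /stereo_map /= !mxE /= -/u.
have w : 1 - (-1) ^+ b * ((normz1 u - normz2 u) / normz u)
    = 2 * affine_norm b u / normz u.
  move: u0; rewrite /affine_norm /normz.
  by case: (b) => u0; rewrite ?expr0 ?expr1; field.
apply: row2_eq; rewrite !mxE /= w;
  move: u0 zb; rewrite /affine_set /affine_norm /normz /normz1 /normz2 /=;
  case: b {w} => u0 zb /=; field; by rewrite ?zb ?u0.
Qed.

Definition line_chart : chart R R 1 := @chart_at R (real_line R) (0 : R).

Lemma rational_proj b : rational_on (affine_set b)
  (chart_map (prod_chart (M := sphere2 R) (N := real_line R)
               (stereo R b) line_chart)
     \o hopf_proj \o insubd (total_base (R := R)))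
  (fun _ => proj_coef b).
Proof.
move=> u i j; rewrite ord1 => ub; have ut := affine_total ub.
have ub' : affine_set b (\val (insubd (total_base (R := R)) u)) by rewrite open_chartK.
split.
  move: ub; rewrite /affine_set /affine_norm /normz1 /normz2.
  by case: b {ub'}; case: j => [[|[|[|//]]] j3] /= ub; rewrite ?ub.
rewrite /=; case: (split_ordP j) => k ->.
  by rewrite row_mxEl stereo_hopf // mxE open_chartK.
rewrite row_mxEr mxE open_chartK // /proj_coef.
by rewrite [k]ord1.
Qed.

End Hopf.

(** * Push-forward of a graph, at a point *)

Lemma bilinear_ext {F : fieldType} {n : nat} (A B : 'M[F]_n) :
  (forall X Y : 'rV_n, (X *m A *m Y^T) 0 0 = (X *m B *m Y^T) 0 0) -> A = B.
Proof.
move=> AB; apply/matrixP => i j.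
have := AB (delta_mx 0 i) (delta_mx 0 j).
by rewrite trmx_delta -!rowE -!colE !mxE.
Qed.

Section DiracLinearAlgebra.
Context {F : fieldType} {n m : nat}.
Context (D : 'M[F]_(n, m + 1)) (A : 'M[F]_m) (alpha : 'cV[F]_n) (V : 'rV[F]_n).
Let Ds : 'M[F]_(n, m) := lsubmx D.
Let Dt : 'M[F]_(n, 1) := rsubmx D.
Let w : 'M[F]_n := Ds *m A *m Ds^T + Dt *m alpha^T - alpha *m Dt^T.
Hypotheses (uA : A \in unitmx) (fD : row_full D).
Hypotheses (VD : V *m D = 0) (Valpha : V *m alpha = 1%:M).

(** Here D is dp, with blocks Ds and Dt tangent to the leaf and transverse to
    it, and the form w is the pull-back of the leaf form A plus dt /\ alpha;
    the vector V is vertical with alpha(V) = 1. If i_X w is the pull-back of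
    b, then contracting with V gives dt(X) = 0, and what remains says that
    i_(dp X) A is the leaf part of b. Conversely, a lift of the vector so
    determined can be corrected by a multiple of V to make - alpha(X) equal to
    the dt-component of b. *)
Lemma linear_pushforward (Y : 'rV[F]_(m + 1)) (b : 'cV[F]_(m + 1)) :
  (exists2 X, Y = X *m D & X *m w = (D *m b)^T) <->
  Y = row_mx ((usubmx b)^T *m invmx A) 0.
Proof.
have DE : D = row_mx Ds Dt by rewrite hsubmxK.
have VDs : V *m Ds = 0 by rewrite mulmx_lsub VD linear0.
have VDt : V *m Dt = 0 by rewrite mulmx_rsub VD linear0.
have DbE : (D *m b)^T = (usubmx b)^T *m Ds^T + (dsubmx b)^T *m Dt^T.
  by rewrite DE -{1}[b]vsubmxK mul_row_col linearD /= !trmx_mul.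
have XwE X : X *m w = X *m Ds *m A *m Ds^T + X *m Dt *m alpha^T - X *m alpha *m Dt^T.
  by rewrite /w mulmxBr mulmxDr !mulmxA.
split=> [[X -> Xw]|->].
- have XDt : X *m Dt = 0.
    have : X *m w *m V^T = 0 by rewrite Xw -trmx_mul mulmxA VD mul0mx trmx0.
    rewrite XwE mulmxBl mulmxDl -!mulmxA -!trmx_mul VDs VDt Valpha.
    by rewrite !trmx0 !mulmx0 trmx1 mulmx1 add0r subr0.
  (* D^T is injective because dp is surjective, so coefficients in the
     pull-backs along Ds and Dt can be compared. *)
  have fDt : row_free D^T by rewrite /row_free mxrank_tr; exact: fD.
  have : row_mx (X *m Ds *m A) (- (X *m alpha)) *m D^T =
      row_mx (usubmx b)^T (dsubmx b)^T *m D^T.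
    rewrite {1 2}DE tr_row_mx !mul_row_col -DbE -Xw XwE XDt mul0mx addr0.
    by rewrite mulNmx.
  move=> /(row_free_inj fDt) /eq_row_mx[<- _].
  by rewrite mulmxK // DE mul_mx_row XDt.
- have /row_fullP[B BD] := fD.
  pose X0 := row_mx ((usubmx b)^T *m invmx A) 0 *m B.
  have X0D : X0 *m D = row_mx ((usubmx b)^T *m invmx A) 0.
    by rewrite -mulmxA BD mulmx1.
  pose X := X0 + (- (dsubmx b)^T - X0 *m alpha) *m V.
  have XD : X *m D = row_mx ((usubmx b)^T *m invmx A) 0.
    by rewrite mulmxDl X0D -mulmxA VD mulmx0 addr0.
  exists X; first by rewrite XD.
  have XDs : X *m Ds = (usubmx b)^T *m invmx A by rewrite mulmx_lsub XD row_mxKl.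
  have XDt : X *m Dt = 0 by rewrite mulmx_rsub XD row_mxKr.
  have Xalpha : X *m alpha = - (dsubmx b)^T.
    by rewrite mulmxDl -mulmxA Valpha mulmx1 addrC subrK.
  by rewrite XwE XDs XDt Xalpha mulmxKV // mul0mx addr0 mulNmx opprK DbE.
Qed.

End DiracLinearAlgebra.

(** * Poisson structures with the prescribed leaves *)

Section SphereLeaves.
Context {R : realType}.

Lemma leaf_incl_diff (t : R) (s : sphere2 R) (u : 'rV[R]_2) :
  u *m mdiff (leaf_incl (R := R) t) s = row_mx u 0.
Proof.
set b := is_north (\val s).
pose x (k : 'I_2) : ratfun R 2 := RVar k.
pose e (j : 'I_3) := nth (RCst 0) [:: x 'c_0; x 'c_1; RCst t] j.
have re : rational_on setT
    (chart_map (prod_chart (M := sphere2 R) (N := real_line R)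
                 (stereo R b) (line_chart (R := R)))
      \o leaf_incl t \o chart_inv (stereo R b)) (fun _ => e).
  move=> v i j _; rewrite ord1.
  split; first by case: j => [[|[|[|//]]] j3].
  have r0 := sum_sqr_add1_neq0 (v#0) (v#1).
  rewrite /=; case: (split_ordP j) => k ->; last by rewrite row_mxEr mxE [k]ord1.
  rewrite row_mxEl /stereo_map /stereo_inv_val !mxE /=.
  have -> : (0 : 'I_2) = @Ordinal 2 0 isT by exact: val_inj.
  have -> : (1 : 'I_2) = @Ordinal 2 1 isT by exact: val_inj.
  rewrite !expr2; set p := v#0 in r0 *; set q := v#1 in r0 *.
  have -> : 1 - (-1) ^+ b *
      ((-1) ^+ b * (p * p + q * q - 1) / (p * p + q * q + 1)) =
      2 / (p * p + q * q + 1).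
    by case: (b); rewrite ?expr0 ?expr1; field.
  by move: k; apply: ord2P; rewrite /= -?/p -?/q invf_div; field.
apply/rowP => j.
rewrite (jacobian_rational u j openT re I).
case: (split_ordP j) => k ->; rewrite ?row_mxEl ?row_mxEr.
  by move: k; apply: ord2P.
by rewrite mxE [k]ord1.
Qed.

Lemma leaf_form_unit (t : R) (s : sphere2 R) :
  (1 + t ^+ 2) *: sphere_area s \in unitmx.
Proof.
rewrite unitmxZ ?sphere_area_unit // unitfE.
by rewrite gt_eqF // ltr_wpDr // sqr_ge0.
Qed.

(** The covectors of S^2 x R are mapped by the sharp map into the tangent
    space of the leaf, and the leaf form, being nondegenerate, determines the
    image. *)
Lemma sphere_leaves_sharp (q : bivector (sphere_line R)) : has_sphere_leaves q ->
  forall (s : sphere2 R) (t : R) (a : 'cV[R]_(2 + 1)),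
  sharp q (s, t) a =
  row_mx ((usubmx a)^T *m invmx ((1 + t ^+ 2) *: sphere_area s)) 0.
Proof.
move=> [_ leaf] s t a.
have [[_ _ _ _ /(_ s) /eqmxP rowsp] _ sigma] := leaf t.
have /submxP[u uE] : (sharp q (s, t) a <= mdiff (leaf_incl (R := R) t) s)%MS.
  by rewrite rowsp; exact: submxMl.
have inc : mdiff (leaf_incl (R := R) t) s = row_mx 1%:M 0 :> 'M[R]_(2, 2 + 1).
  rewrite -[LHS]mul1mx; apply/row_matrixP => i.
  by rewrite row_mul leaf_incl_diff row_row_mx linear0.
have := sigma s u a (esym uE).
rewrite inc -{1}[a]vsubmxK mul_row_col mul1mx mul0mx addr0 => /(canRL trmxK).
rewrite /leaf_form => uA.
rewrite uE leaf_incl_diff -uA mulmxK //.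
exact: leaf_form_unit.
Qed.

End SphereLeaves.

(** * The projection and the pull-back of the area form *)

Section Projection.
Context {R : realType}.
Implicit Types (u X Y : 'rV[R]_5) (z : total_set (R := R)).

Let p : total_space (R := R) -> sphere_line R := @hopf_proj R.
Let north z : bool := is_north (\val (hopf z)).

Lemma north_affine z : affine_set (north z) (\val z).
Proof. exact/affine_of_hopf/is_northP. Qed.

Lemma proj_diffE z X (j : 'I_(2 + 1)) :
  (X *m mdiff p z) 0 j = reval (rder X (proj_coef (north z) j)) (\val z).
Proof.
have := jacobian_rational X j (@open_affine R (north z))
  (rational_proj (b := north z)) (north_affine z).
exact.
Qed.

Lemma proj_smooth : smooth_map p.
Proof.
pose x (k : 'I_5) : ratfun R 5 := RVar k.
pose n1 := (x 'c_0 * x 'c_0 + x 'c_1 * x 'c_1)%F.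
pose n2 := (x 'c_2 * x 'c_2 + x 'c_3 * x 'c_3)%F.
pose e (j : 'I_3) := nth (RCst 0)
  [:: (RCst 2 * (x 'c_0 * x 'c_2 + x 'c_1 * x 'c_3)) / (n1 + n2);
      (RCst 2 * (x 'c_0 * x 'c_3 - x 'c_1 * x 'c_2)) / (n1 + n2);
      (n1 - n2) / (n1 + n2)]%F j.
split.
  have chopf : continuous (@hopf R).
    apply: (rational_continuous (e := e) (@continuous_set_val _ _)) => z j.
    have u0 := normz_neq0 z.
    rewrite /= mxE.
    by case: j => [[|[|[|//]]] j3] /=; rewrite ?mulN1r; split => //; exact: u0.
  move=> z; apply: (continuous_pairing (chopf z)).
  exact: (@continuous_coord _ R 1 5 (fun z : total_set => \val z) z 0
    (@Ordinal 5 4 isT) (@continuous_set_val _ _ z)).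
move=> _ _ -> [_ [b _ <-] [_ -> <-]].
apply: smooth_on_subset (rational_smooth (@open_affine R b) (rational_proj (b := b))).
by move=> _ [z [_ [zb _]] <-]; exact: affine_of_hopf.
Qed.

(** The vector (0, z1 v) lifts v through d(z2 / z1), and (z2 conj(v), 0) lifts
    it through d conj(z1 / z2). *)
Definition proj_lift z : 'M[R]_(2 + 1, 5) := let u : 'rV[R]_5 := \val z in
  \matrix_(i, j) if north z then
    (nth 0 (nth [::] [:: [:: 0; 0; u#0; u#1; 0]; [:: 0; 0; - u#1; u#0; 0];
                         [:: 0; 0; 0; 0; 1]] i) j)
  else
    (nth 0 (nth [::] [:: [:: u#2; u#3; 0; 0; 0]; [:: u#3; - u#2; 0; 0; 0];
                         [:: 0; 0; 0; 0; 1]] i) j).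

Lemma proj_liftK z : proj_lift z *m mdiff p z = 1%:M.
Proof.
have zb := north_affine z.
apply/row_matrixP => i; rewrite row_mul; apply/rowP => j.
rewrite proj_diffE !mxE.
move: zb; rewrite /affine_set /affine_norm /normz1 /normz2 /proj_lift /=.
case: (north z) => zb.
  by case: i => [[|[|[|//]]] i3]; case: j => [[|[|[|//]]] j3];
    rewrite /= !mxE /=; field.
by case: i => [[|[|[|//]]] i3]; case: j => [[|[|[|//]]] j3];
    rewrite /= !mxE /=; field.
Qed.

Lemma proj_submersion : submersion p.
Proof.
split; first exact: proj_smooth.
by move=> z; apply/row_fullP; exists (proj_lift z); exact: proj_liftK.
Qed.

(** This is 1 + |u|^2 = |z|^2 / |z_k|^2 for the affine coordinate u with
    denominator z_k. *)
Lemma area_density_hopf b z : affine_set b (\val z) ->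
  area_density (stereo_map b (hopf z)) b =
  - (-1) ^+ b * 4 * (affine_norm b (\val z) * affine_norm b (\val z))
    / (normz (\val z) * normz (\val z)).
Proof.
move=> zb; have z0 := normz_neq0 z.
rewrite /area_density stereo_hopf // !mxE.
set r := (X in _ / (X * X) = _).
have -> : r = normz (\val z) / affine_norm b (\val z).
  rewrite /r; move: zb; rewrite /affine_set /affine_norm /normz /normz1 /normz2.
  by case: (b) => /= zb; field.
by field; rewrite z0; exact: zb.
Qed.

(** The coframes du0, du1 and phi1, phi2 are related by the complex factor 1 /
    z_k^2, up to sign and conjugation: d(z2 / z1) is - (z2 dz1 - z1 dz2) /
    z1^2. The area density cancels the factor 1 / |z_k|^4 and leaves 4 /
    |z|^4. *)
Lemma pullback_area z X Y :
  (X *m lsubmx (mdiff p z) *m sphere_area (hopf z) *m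
    (Y *m lsubmx (mdiff p z))^T) 0 0 =
  4 / (normz (\val z) * normz (\val z)) *
    (phi1 (\val z) X * phi2 (\val z) Y - phi1 (\val z) Y * phi2 (\val z) X).
Proof.
have zb := north_affine z; have z0 := normz_neq0 z.
rewrite sphere_area_bilinear -/(north z) area_density_hopf //.
have lE W (k : 'I_2) : (W *m lsubmx (mdiff p z)) 0 k =
    reval (rder W (proj_coef (north z) (lshift 1 k))) (\val z).
  by rewrite mulmx_lsub mxE proj_diffE.
rewrite !lE; move: zb z0.
rewrite /affine_set /affine_norm /normz /normz1 /normz2 /phi1 /phi2.
by case: (north z) => /= zb z0; rewrite ?expr0 ?expr1; field; rewrite z0.
Qed.

End Projection.

(** * The action of C^* *)

Section Action.
Context {R : realType}.
Implicit Types (g : 'rV[R]_2) (u v X Y : 'rV[R]_5).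

Definition cact g u : 'rV[R]_5 := \row_i
  [:: g#0 * u#0 - g#1 * u#1; g#0 * u#1 + g#1 * u#0;
      g#0 * u#2 - g#1 * u#3; g#0 * u#3 + g#1 * u#2; u#4]`_i.

(** The Hermitian product of v and u divided by |u|^2: on a single C^*-orbit
    this is the group element that carries u to v, given by a formula that
    remains continuous across orbits. *)
Definition cdiv v u : 'rV[R]_2 := \row_i
  [:: (v#0 * u#0 + v#1 * u#1 + (v#2 * u#2 + v#3 * u#3)) / normz u;
      (v#1 * u#0 - v#0 * u#1 + (v#3 * u#2 - v#2 * u#3)) / normz u]`_i.

Lemma normz_cact g u : normz (cact g u) = norm2 g * normz u.
Proof. by rewrite /normz /normz1 /normz2 /norm2 !mxE /=; ring. Qed.

Lemma cact_cdivK g u : normz u != 0 -> cdiv (cact g u) u = g.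
Proof.
rewrite /cdiv => u0; move: (u0); rewrite /normz /normz1 /normz2 => u0'.
by apply: row2_eq; rewrite !mxE /= /normz /normz1 /normz2; field.
Qed.

Lemma hopf_cact g u : norm2 g != 0 -> normz u != 0 ->
  hopf_val (cact g u) = hopf_val u.
Proof.
move=> g0 u0; rewrite /hopf_val normz_cact /normz1 /normz2 !mxE /=.
move: g0 u0; rewrite /norm2 => g0 u0.
by congr coord3; field; rewrite g0 u0.
Qed.

(** The Hopf image of z carries the same information as the orthogonal
    projector z z^* / |z|^2 onto the line of z. The product of cdiv v u with u
    is the image of v under the projector of u; when the two projectors agree
    this is v. *)
Lemma cdiv_cactK u v : normz u != 0 -> normz v != 0 ->
  hopf_val u = hopf_val v -> u#4 = v#4 -> cact (cdiv v u) u = v.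
Proof.
move=> u0 v0 /rowP huv uv4.
have h0 : 2 * (u#0 * u#2 + u#1 * u#3) / normz u =
    2 * (v#0 * v#2 + v#1 * v#3) / normz v.
  by have := huv (@Ordinal 3 0 isT); rewrite !mxE.
have h1 : 2 * (u#0 * u#3 - u#1 * u#2) / normz u =
    2 * (v#0 * v#3 - v#1 * v#2) / normz v.
  by have := huv (@Ordinal 3 1 isT); rewrite !mxE.
have h2 : (normz1 u - normz2 u) / normz u = (normz1 v - normz2 v) / normz v.
  by have := huv (@Ordinal 3 2 isT); rewrite !mxE.
have n1 : normz1 u / normz u = normz1 v / normz v.
  have e w : normz w != 0 ->
      normz1 w / normz w = (1 + (normz1 w - normz2 w) / normz w) / 2.
    by rewrite /normz => w0; field.
  by rewrite !e // h2.
have n2 : normz2 u / normz u = normz2 v / normz v.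
  have e w : normz w != 0 ->
      normz2 w / normz w = (1 - (normz1 w - normz2 w) / normz w) / 2.
    by rewrite /normz => w0; field.
  by rewrite !e // h2.
have half (x y : R) : 2 * x / normz u = 2 * y / normz v ->
    x / normz u = y / normz v.
  by move=> e; apply: (@mulfI _ 2); rewrite ?pnatr_eq0 // !mulrA.
have {h0}h0 := half _ _ h0; have {h1}h1 := half _ _ h1.
have vE : normz v = v#0 * v#0 + v#1 * v#1 + (v#2 * v#2 + v#3 * v#3) by [].
apply: row5_eq; rewrite !mxE //=.
- transitivity (v#0 * (normz1 u / normz u)
    + v#2 * ((u#0 * u#2 + u#1 * u#3) / normz u)
    + v#3 * ((u#0 * u#3 - u#1 * u#2) / normz u)).
    by rewrite /normz1; field.
  by rewrite n1 h0 h1 /normz1; move: v0; rewrite vE => v0; field.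
- transitivity (v#1 * (normz1 u / normz u)
    + v#3 * ((u#0 * u#2 + u#1 * u#3) / normz u)
    - v#2 * ((u#0 * u#3 - u#1 * u#2) / normz u)).
    by rewrite /normz1; field.
  by rewrite n1 h0 h1 /normz1; move: v0; rewrite vE => v0; field.
- transitivity (v#2 * (normz2 u / normz u)
    + v#0 * ((u#0 * u#2 + u#1 * u#3) / normz u)
    - v#1 * ((u#0 * u#3 - u#1 * u#2) / normz u)).
    by rewrite /normz2; field.
  by rewrite n2 h0 h1 /normz2; move: v0; rewrite vE => v0; field.
- transitivity (v#3 * (normz2 u / normz u)
    + v#1 * ((u#0 * u#2 + u#1 * u#3) / normz u)
    + v#0 * ((u#0 * u#3 - u#1 * u#2) / normz u)).
    by rewrite /normz2; field.
  by rewrite n2 h0 h1 /normz2; move: v0; rewrite vE => v0; field.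
Qed.

Lemma act_subproof (g : cstar_set (R := R)) (z : total_set (R := R)) :
  cact (\val g) (\val z) \in total_set (R := R).
Proof.
apply/mem_set; rewrite /total_set /= normz_cact mulf_neq0 ?normz_neq0 //.
exact: cstar_norm2.
Qed.

Definition act (g : cstar_group (R := R)) (z : total_space (R := R)) :
    total_space :=
  exist (fun u => u \in total_set (R := R)) _ (act_subproof g z).

Lemma act_smooth :
  @smooth_map R (prod_manifold (cstar (R := R)) (total_space (R := R)))
    total_space (fun z => act z.1 z.2).
Proof.
pose g k : ratfun R (2 + 5) := RVar (lshift 5 k).
pose x k : ratfun R (2 + 5) := RVar (rshift 2 k).
pose e (j : 'I_5) := nth (RCst 0)
  [:: g 'c_0 * x 'c_0 - g 'c_1 * x 'c_1; g 'c_0 * x 'c_1 + g 'c_1 * x 'c_0;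
      g 'c_0 * x 'c_2 - g 'c_1 * x 'c_3; g 'c_0 * x 'c_3 + g 'c_1 * x 'c_2;
      x 'c_4]%F j.
apply: (rational_smooth_map2 cstar_one total_base total_base open_cstar
  open_total (e := e)).
by move=> z; apply: ord5P; split => //;
  rewrite /= ?row_mxEl ?row_mxEr mxE /= ?mulN1r.
Qed.

Lemma act_smooth_action : smooth_action (G := cstar_group) act.
Proof.
split; last exact: act_smooth.
- move=> z; apply: val_inj.
  by apply: row5_eq; rewrite /= mxE /= ?mxE /=; ring.
- move=> g h z; apply: val_inj.
  by apply: row5_eq; rewrite /= !mxE /=; ring.
Qed.

Lemma act_free : free_action (G := cstar_group) act.
Proof.
move=> g z gz; apply: val_inj; rewrite -[LHS](cact_cdivK _ (normz_neq0 z)).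
rewrite -[cact _ _]/(\val (act g z)) gz.
have e : cact cunit (\val z) = \val z.
  by apply: row5_eq; rewrite !mxE /= ?mxE /=; ring.
by rewrite -[RHS](cact_cdivK _ (normz_neq0 z)) e.
Qed.

(** The action is linear in z and fixes t, hence is its own derivative. *)
Lemma act_diff (g : cstar_group (R := R)) (z : total_space (R := R)) X :
  X *m mdiff (act g) z = cact (\val g) X.
Proof.
pose x k : ratfun R 5 := RVar k.
pose g0 : ratfun R 5 := RCst (\val g)#0.
pose g1 : ratfun R 5 := RCst (\val g)#1.
pose e (j : 'I_5) := nth (RCst 0)
  [:: g0 * x 'c_0 - g1 * x 'c_1; g0 * x 'c_1 + g1 * x 'c_0;
      g0 * x 'c_2 - g1 * x 'c_3; g0 * x 'c_3 + g1 * x 'c_2; x 'c_4]%F j.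
have re : rational_on (total_set (R := R))
    ((fun z : total_set => \val z) \o act g \o insubd total_base) (fun _ => e).
  move=> u i j zu; rewrite ord1; move: j.
  by apply: ord5P; split => //; rewrite /= mxE /= open_chartK // ?mulN1r.
apply/rowP => j.
rewrite (jacobian_rational X j open_total re (set_valP z)) /cact [RHS]mxE.
by move: j; apply: ord5P; rewrite /=; ring.
Qed.

(** The two factors phi1 /\ phi2 and |z|^4 are both multiplied by |g|^4, and
    eta, rho and |z|^2 all by |g|^2. *)
Lemma act_preserves : preserves_form (G := cstar_group) act (total_form (R := R)).
Proof.
move=> g z; rewrite /pullback; apply: bilinear_ext => X Y.
rewrite !mulmxA -mulmxA -trmx_mul !act_diff !total_formE.
have g0 := cstar_norm2 g; have z0 := normz_neq0 z.
rewrite /alpha normz_cact.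
move: g0 z0; set n2 := norm2 _; set nz := normz _ => g0 z0.
have phiE : phi1 (cact (\val g) (\val z)) (cact (\val g) X) *
    phi2 (cact (\val g) (\val z)) (cact (\val g) Y) -
    phi1 (cact (\val g) (\val z)) (cact (\val g) Y) *
    phi2 (cact (\val g) (\val z)) (cact (\val g) X) = n2 * n2 *
    (phi1 (\val z) X * phi2 (\val z) Y - phi1 (\val z) Y * phi2 (\val z) X).
  by rewrite /phi1 /phi2 /n2 /norm2 !mxE /=; ring.
have etaE W : angular_form (cact (\val g) (\val z)) (cact (\val g) W) =
    n2 * angular_form (\val z) W.
  by rewrite /angular_form /n2 /norm2 !mxE /=; ring.
have rhoE W : radial_form (cact (\val g) (\val z)) (cact (\val g) W) =
    n2 * radial_form (\val z) W.
  by rewrite /radial_form /n2 /norm2 !mxE /=; ring.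
have c4 W : cact (\val g) W 0 (@Ordinal 5 4 isT) = W#4 by rewrite mxE.
rewrite [X in _ * X + _]phiE !etaE !rhoE !c4.
by field; rewrite g0 z0.
Qed.

End Action.

(** * The quotient *)

Section Quotient.
Context {R : realType}.
Let M : premanifold R := total_space.
Let p : M -> sphere_line R := @hopf_proj R.
Implicit Types (u v X Y : 'rV[R]_5).

Lemma proj_act g (z : M) : p (act g z) = p z.
Proof.
rewrite /p /hopf_proj; congr (_, _); last by rewrite /= mxE.
apply: val_inj; apply: hopf_cact; last exact: normz_neq0.
exact: cstar_norm2.
Qed.

Lemma proj_eq (y z : M) : p z = p y ->
  hopf_val (\val z) = hopf_val (\val y) /\
  (\val z : 'rV[R]_5)#4 = (\val y : 'rV[R]_5)#4.
Proof. by move=> [hzy tzy]; split. Qed.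

Lemma cdiv_cstar (y z : M) : p z = p y -> cstar_set (cdiv (\val y) (\val z)).
Proof.
move=> /proj_eq[hzy tzy].
have := cdiv_cactK (normz_neq0 z) (normz_neq0 y) hzy tzy.
move=> /(congr1 normz); rewrite normz_cact => nE.
have := normz_neq0 y; rewrite -nE /cstar_set /=.
by apply: contra => /eqP ->; rewrite mul0r.
Qed.

Definition quotient_elt (y z : M) : cstar_group :=
  insubd cstar_one (cdiv (\val y) (\val z)).

Lemma act_quotient_elt (y z : M) : p z = p y -> act (quotient_elt y z) z = y.
Proof.
move=> pzy; have [hzy tzy] := proj_eq pzy; apply: val_inj.
rewrite /= open_chartK; last exact: cdiv_cstar.
exact: cdiv_cactK (normz_neq0 z) (normz_neq0 y) hzy tzy.
Qed.

Lemma proj_surjective : set_surj [set: M] [set: sphere_line R] p.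
Proof.
move=> [s t] _.
set b := is_north (\val s); set c := stereo_map b s.
(* The affine coordinate of (1, c) is c in one chart; that of (conj(c), 1) is c
   in the other. *)
pose u : 'rV[R]_5 := if b then \row_i [:: 1; 0; c#0; c#1; t]`_i
  else \row_i [:: c#0; - c#1; 1; 0; t]`_i.
have c0 := sum_sqr_add1_neq0 (c#0) (c#1).
have uE : normz u = c#0 * c#0 + c#1 * c#1 + 1.
  by rewrite /u /normz /normz1 /normz2; case: (b); rewrite !mxE /=; ring.
have u0 : u \in total_set by apply/mem_set; rewrite /total_set /= uE.
exists (exist (fun u => u \in total_set) u u0) => //.
rewrite /p /hopf_proj; congr (_, _); last first.
  by rewrite /= /u; case: (b); rewrite mxE.
apply: val_inj; rewrite /= -(@stereo_mapK R b s); last exact: is_northP.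
rewrite -/c; apply/rowP => j.
have [_ ->] := @stereo_inv_rational R b c 0 j I.
rewrite /hopf_val uE mxE /u /normz1 /normz2.
case: (b); case: j => [[|[|[|//]]] j3];
  rewrite /= !mxE /= ?expr0 ?expr1; congr (_ / _); ring.
Qed.

Lemma proj_quotient : quotient_map (G := cstar_group) (M := M) act p.
Proof.
split; [exact: proj_submersion|exact: proj_surjective|].
move=> y z; split=> [pyz|[g ->]]; last by rewrite proj_act.
by exists (quotient_elt z y); rewrite act_quotient_elt.
Qed.

Lemma hopf_proj_continuous : continuous (@hopf_proj R).
Proof. exact: (proj_submersion.1.1). Qed.

Lemma cdiv_continuous :
  continuous (fun k : M * M => cdiv (\val k.1) (\val k.2)).
Proof.
pose y k : ratfun R (5 + 5) := RVar (lshift 5 k).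
pose x k : ratfun R (5 + 5) := RVar (rshift 5 k).
pose r := (x 'c_0 * x 'c_0 + x 'c_1 * x 'c_1 + (x 'c_2 * x 'c_2 + x 'c_3 * x 'c_3))%F.
pose e (j : 'I_2) := nth (RCst 0)
  [:: (y 'c_0 * x 'c_0 + y 'c_1 * x 'c_1 + (y 'c_2 * x 'c_2 + y 'c_3 * x 'c_3)) / r;
      (y 'c_1 * x 'c_0 - y 'c_0 * x 'c_1 + (y 'c_3 * x 'c_2 - y 'c_2 * x 'c_3)) / r]%F j.
apply: (@rational_comp_continuous _ (M * M)%type _ _
  (fun k => row_mx (\val k.1) (\val k.2)) _ e).
  move=> k; apply: (continuous_row_mx (T := (M * M)%type) (f := fun z => \val z.1)
    (g := fun z => \val z.2)).
    apply: (continuous_comp (f := fst)); first exact: cvg_fst.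
    exact: continuous_set_val.
  apply: (continuous_comp (f := snd)); first exact: cvg_snd.
  exact: continuous_set_val.
move=> k; have k0 := normz_neq0 k.2; apply: ord2P; split;
  rewrite /= ?row_mxEl ?row_mxEr ?mxE /= ?mulN1r //; exact: k0.
Qed.

Lemma same_orbit_closed : closed [set k : M * M | p k.2 = p k.1].
Proof.
have csnd : continuous (@snd M M) by move=> k; exact: cvg_snd.
have cfst : continuous (@fst M M) by move=> k; exact: cvg_fst.
have chopf : continuous (fun z : M => (p z).1).
  move=> z; apply: (@continuous_comp M (unit_sphere (R := R) * R)%type _ p fst).
    exact: hopf_proj_continuous.
  exact: cvg_fst.
have cline : continuous (fun z : M => (p z).2).
  move=> z; apply: (@continuous_comp M (unit_sphere (R := R) * R)%type _ p snd).
    exact: hopf_proj_continuous.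
  exact: cvg_snd.
rewrite (_ : [set _ | _] = [set k : M * M | (p k.2).1 = (p k.1).1] `&`
                           [set k : M * M | (p k.2).2 = (p k.1).2]).
  apply: closedI.
  - apply: (@closed_eq_fun (M * M)%type (unit_sphere (R := R))
      (fun k => (p k.2).1) (fun k => (p k.1).1)).
    + exact/set_type_hausdorff/norm_hausdorff.
    + by move=> k; apply: (@continuous_comp (M * M)%type M (unit_sphere (R := R)) snd
        (fun z => (p z).1) k (csnd k)); exact: chopf.
    + by move=> k; apply: (@continuous_comp (M * M)%type M (unit_sphere (R := R)) fst
        (fun z => (p z).1) k (cfst k)); exact: chopf.
  - apply: (@closed_eq_fun (M * M)%type R (fun k => (p k.2).2) (fun k => (p k.1).2)).
    + exact: Rhausdorff.
    + by move=> k; apply: (@continuous_comp (M * M)%type M R snd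
        (fun z => (p z).2) k (csnd k)); exact: cline.
    + by move=> k; apply: (@continuous_comp (M * M)%type M R fst
        (fun z => (p z).2) k (cfst k)); exact: cline.
apply/seteqP; split=> [k e|k [e1 e2]].
  by split; [exact: (congr1 fst e)|exact: (congr1 snd e)].
exact: (congr2 pair e1 e2).
Qed.

(** The pairs (y, z) with p y = p z form a closed set, over which (g, z) is
    recovered from (g z, z) by a continuous map; so the preimage of a compact
    set is the continuous image of a compact set. *)
Lemma act_proper : proper_action (G := cstar_group) (M := M) act.
Proof.
move=> K cK.
pose E := [set k : M * M | p k.2 = p k.1].
pose F (k : M * M) : cstar_group * M := (quotient_elt k.1 k.2, k.2).
have -> : (fun z : cstar_group * M => (act z.1 z.2, z.2)) @^-1` K = F @` (K `&` E).
  apply/seteqP; split=> [[g z] /= Kgz|_ [[y z] /= [Kk Ek] <-] /=].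
    exists (act g z, z); first by split=> //; rewrite /E /= proj_act.
    rewrite /F /=; congr (_, _).
    by rewrite /quotient_elt /= cact_cdivK ?normz_neq0 // valKd.
  by rewrite act_quotient_elt.
apply: continuous_compact; last first.
  by apply: compact_closedI => //; exact: same_orbit_closed.
apply: continuous_in_subspaceT => k /set_mem [_ Ek].
apply: (@continuous_pairing (M * M)%type cstar_group M
  (fun k => quotient_elt k.1 k.2) snd k).
  apply: (@continuous_comp (M * M)%type 'rV[R]_2 cstar_group
    (fun k => cdiv (\val k.1) (\val k.2)) (insubd cstar_one) k).
    exact: cdiv_continuous.
  exact: (@open_chart_inv_continuous _ _ _ cstar_one open_cstar _ (cdiv_cstar Ek)).
exact: cvg_snd.
Qed.

End Quotient.

(** * The forward Dirac property *)

Section ForwardDirac.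
Context {R : realType}.
Let M : premanifold R := total_space.
Let p : M -> sphere_line R := @hopf_proj R.
Implicit Types (u X Y : 'rV[R]_5).

Definition alpha_col u : 'cV[R]_5 := \col_i
  [:: (u#0 - 4 * u#4 * u#1) / normz u; (u#1 + 4 * u#4 * u#0) / normz u;
      (u#2 - 4 * u#4 * u#3) / normz u; (u#3 + 4 * u#4 * u#2) / normz u; 0]`_i.

Lemma alpha_colE u X : (X *m alpha_col u) 0 0 = alpha u X.
Proof.
rewrite mxE sum_ord5 !mxE /= /alpha /angular_form /radial_form; ring.
Qed.

(** The direction of the real scalings in C^*: it is vertical and pairs to 1
    with alpha for all t, including t = 0 where the angular part of alpha
    vanishes. *)
Definition radial_vector u : 'rV[R]_5 := \row_i [:: u#0; u#1; u#2; u#3; 0]`_i.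

Lemma radial_vector_vertical (z : M) : radial_vector (\val z) *m mdiff p z = 0.
Proof.
have zb := north_affine z.
apply/rowP => j; rewrite [LHS]proj_diffE [RHS]mxE.
move: zb; rewrite /affine_set /affine_norm /normz1 /normz2.
by case: (is_north _) => /= zb; case: j => [[|[|[|//]]] j3];
  rewrite /= !mxE /=; field.
Qed.

Lemma alpha_radial (z : M) : radial_vector (\val z) *m alpha_col (\val z) = 1%:M.
Proof.
apply/rowP => i; rewrite ord1 alpha_colE mxE.
have := normz_neq0 z.
rewrite /alpha /angular_form /radial_form /normz /normz1 /normz2 !mxE /= => z0.
by field.
Qed.

Lemma total_form_split (z : M) (D := mdiff p z) :
  total_form z =
    lsubmx D *m ((1 + (p z).2 ^+ 2) *: sphere_area (p z).1) *m (lsubmx D)^T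
    + rsubmx D *m (alpha_col (\val z))^T - alpha_col (\val z) *m (rsubmx D)^T.
Proof.
apply: bilinear_ext => X Y.
have entry (a b : 'M[R]_1) : (a *m b) 0 0 = a 0 0 * b 0 0.
  by rewrite mxE big_ord1.
have last W : (W *m rsubmx D) 0 0 = W#4.
  by rewrite mulmx_rsub mxE proj_diffE.
rewrite total_formE mulmxBr mulmxDr mulmxBl mulmxDl.
have -> (a b c : 'M[R]_1) : (a + b - c) 0 0 = a 0 0 + b 0 0 - c 0 0 by rewrite !mxE.
congr (_ + _ - _).
- rewrite !mulmxA -mulmxA -trmx_mul -scalemxAr -scalemxAl mxE pullback_area.
  by rewrite /= expr2; ring.
- rewrite !mulmxA -mulmxA -trmx_mul entry last; congr (_ * _).
  by rewrite mxE alpha_colE.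
- rewrite !mulmxA -mulmxA -trmx_mul entry alpha_colE mulrC; congr (_ * _).
  by rewrite mxE last.
Qed.

Lemma total_form_forward_dirac (q : bivector (sphere_line R)) :
  has_sphere_leaves q ->
  forward_dirac p (graph_form total_form) (graph_bivector q).
Proof.
move=> hq z; set D := mdiff p z.
pose A := (1 + (p z).2 ^+ 2) *: sphere_area (p z).1.
have push (W : 'rV[R]_(2 + 1)) (b : 'cV[R]_(2 + 1)) :=
  @linear_pushforward _ _ _ D A (alpha_col (\val z)) (radial_vector (\val z))
    (leaf_form_unit _ _) (proj_submersion.2 z) (radial_vector_vertical z)
    (alpha_radial z) W b.
have sharpE b : sharp q (p z) b = row_mx ((usubmx b)^T *m invmx A) 0.
  by rewrite [p z]surjective_pairing (sphere_leaves_sharp hq).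
have wE := total_form_split z; rewrite -/D -/A in wE.
apply/seteqP; split=> [[W b] [X /= WE [X' _ [-> Xw]]]|_ [b _ <-]].
  exists b => //; congr (_, _); rewrite sharpE; apply/esym/push.
  by exists X => //; rewrite -wE -Xw trmxK.
have [X XD Xw] := (push _ b).2 (sharpE b).
exists X => //=; exists X => //; congr (_, _).
by rewrite wE Xw trmxK.
Qed.

End ForwardDirac.

Theorem proposition6p4 (R : realType) (piP : bivector (sphere_line R))
    (hpiP : has_sphere_leaves piP) :
  exists (G : lie_group R) (M : premanifold R) (w : form2 M)
         (act : G -> M -> M) (p : M -> sphere_line R),
    (is_manifold M /\ presymplectic w) /\
    [/\ smooth_action act, free_action act, proper_action act
      & preserves_form act w] /\
    quotient_map act p /\
    forward_dirac p (graph_form w) (graph_bivector piP).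
Proof.
exists cstar_group, total_space, total_form, act, (@hopf_proj R).
split; first split.
- exact: open_submanifold_manifold open_total.
- exact: total_form_presymplectic.
split; [split|split].
- exact: act_smooth_action.
- exact: act_free.
- exact: act_proper.
- exact: act_preserves.
- exact: proj_quotient.
- exact: total_form_forward_dirac.
Qed.
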